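(* Let $X=\{X(t), t\in\mathbb{R}^d\}$ be a stochastically continuous and proper wide-sense operator-self-similar (w.o.s.s.) random field with values in $\mathbb{R}^m$ and time-variable scaling exponent $E\in Q(\mathbb{R}^d)$. Then there exist a matrix $D\in M(\mathbb{R}^m)$ and a function $(r,t)\mapsto b_r(t)$ from $(0,\infty)\times\mathbb{R}^d$ to $\mathbb{R}^m$, continuous at every $(r,t)\in(0,\infty)\times\mathbb{R}^d$, such that for all constants $r>0$ $$\{X(r^E t),\ t\in\mathbb{R}^d\}\stackrel{d}{=}\{r^D X(t)+b_r(t),\ t\in\mathbb{R}^d\}.$$ Furthermore, $X(0)=a$ a.s. for some constant vector $a\in\mathbb{R}^m$ if and only if $D\in Q(\mathbb{R}^m)$. In this latter case, if one defines $b_0(t)\equiv a$ for all $t\in\mathbb{R}^d$, then the function $(r,t)\mapsto b_r(t)$ is continuous on $[0,\infty)\times\mathbb{R}^d$.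
   Context: $d\ge 2$ and $m\ge 2$ are fixed integers. $\stackrel{d}{=}$ means equality of all finite-dimensional distributions. For a square matrix $A$ and $r>0$, $r^A:=\sum_{n\ge 0}\frac{(\ln r)^n A^n}{n!}$. $Q(\mathbb{R}^n)$ is the set of invertible real $n\times n$ matrices all of whose eigenvalues have positive real parts. $M(\mathbb{R}^n)$ is the set of real $n\times n$ matrices all of whose eigenvalues have nonnegative real parts and such that every eigenvalue with real part zero (if any) is a simple root of the minimal polynomial. A random field $X=\{X(t),t\in\mathbb{R}^d\}$ with values in $\mathbb{R}^m$ is w.o.s.s. with time-variable scaling exponent $E\in Q(\mathbb{R}^d)$ if for every constant $r>0$ there exist a non-random $m\times m$ matrix $B(r)$ and a non-random function $a_r(\cdot):\mathbb{R}^d\to\mathbb{R}^m$ such that $\{X(r^Et),t\in\mathbb{R}^d\}\stackrel{d}{=}\{B(r)X(t)+a_r(t),t\in\mathbb{R}^d\}$. A probability measure on $\mathbb{R}^m$ is full if its support is not contained in any proper hyperplane (i.e. affine hyperplane) of $\mathbb{R}^m$. $X$ is proper if for each $t\neq 0$ the distribution of $X(t)$ is full. $X$ is stochastically continuous if it is continuous in probability at every $t\in\mathbb{R}^d$. *)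

(* Defs.v *)
From mathcomp Require Import all_boot all_order all_algebra.
From mathcomp Require Import complex.
From mathcomp Require Import all_classical all_reals all_analysis.
Set Implicit Arguments.
Unset Strict Implicit.
Unset Printing Implicit Defensive.
Import Order.TTheory GRing.Theory Num.Theory.
Import numFieldNormedType.Exports.
Local Open Scope classical_set_scope.
Local Open Scope ring_scope.

Notation borel V := (g_sigma_algebraType (@open V)).

(* The eigenvalues of a real matrix are taken in R[i]. *)
Definition ceigenvalue (R : realType) (n : nat) (A : 'M[R]_n) (z : R[i]) : Prop :=
  eigenvalue (map_mx (real_complex R) A) z.

Definition Qmx (R : realType) (n : nat) (A : 'M[R]_n) : Prop :=
  A \in unitmx /\ forall z, ceigenvalue A z -> 0 < complex.Re z.

(* [mxminpoly] only exists for matrices of size n.+1; multiplicity 1 means that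
   z is a simple root of the minimal polynomial. *)
Definition Mmx (R : realType) (n : nat) (A : 'M[R]_n.+1) : Prop :=
  forall z, ceigenvalue A z ->
    0 <= complex.Re z /\
    (complex.Re z = 0 -> mup z (map_poly (real_complex R) (mxminpoly A)) = 1%N).

(* Only meaningful for 0 < r, as [ln r = 0] for r <= 0. *)
Definition rpowmx (R : realType) (n : nat) (r : R) (A : 'M[R]_n) : 'M[R]_n :=
  limn (series (fun k : nat => (ln r ^+ k / k`!%:R) *: A ^+ k)).

(* The smallest closed set of full measure, written pointwise: the points all of
   whose open neighbourhoods are charged by mu. *)
Definition msupport (R : realType) (V : ptopologicalType)
    (mu : set (borel V) -> \bar R) : set V :=
  [set x | forall U : set V, open U -> U x -> (0 < mu U)%E].

Definition full (R : realType) (n : nat)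
    (mu : set (borel 'cV[R]_n) -> \bar R) : Prop :=
  ~ exists (c : 'rV[R]_n) (q : R),
      c != 0 /\ msupport mu `<=` [set x | (c *m x) 0 0 = q].

Section RandomField.
Context {R : realType} {d n : nat} {disp : measure_display}.
Context {T : measurableType disp}.
Variable P : probability T R.
Implicit Types X Y : 'cV[R]_d -> T -> 'cV[R]_n.

Definition random_field X : Prop :=
  forall t, measurable_fun [set: T] (X t : T -> borel 'cV[R]_n).

Definition law (Z : T -> 'cV[R]_n) : set (borel 'cV[R]_n) -> \bar R :=
  pushforward P (Z : T -> borel 'cV[R]_n).

(* (X(t_1), ..., X(t_k)) is encoded as the matrix whose j-th column is X(t_j). *)
Definition joint X (k : nat) (t : 'I_k -> 'cV[R]_d) (w : T) : 'M[R]_(n, k) :=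
  \matrix_(i, j) X (t j) w i 0.

Definition eq_fdd X Y : Prop :=
  forall (k : nat) (t : 'I_k -> 'cV[R]_d) (B : set (borel 'M[R]_(n, k))),
    measurable B -> P (joint X t @^-1` B) = P (joint Y t @^-1` B).

Definition proper_field X : Prop := forall t, t != 0 -> full (law (X t)).

(* The norm is the sup norm; all norms give the same notion. *)
Definition stochastically_continuous X : Prop :=
  forall (t : 'cV[R]_d) (eps : R), 0 < eps ->
    P [set w | eps < `|X s w - X t w|] @[s --> t] --> 0%E.

Definition woss (E : 'M[R]_d) X : Prop :=
  Qmx E /\
  forall r : R, 0 < r ->
    exists (B : 'M[R]_n) (a : 'cV[R]_d -> 'cV[R]_n),
      eq_fdd (fun t => X (rpowmx r E *m t)) (fun t w => B *m X t w + a t).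

End RandomField.

(* Main.v *)
Require Import Defs.
From mathcomp Require Import all_boot all_order all_algebra.
From mathcomp Require Import complex.
From mathcomp Require Import all_classical all_reals all_analysis.
From mathcomp Require Import ring lra.
Set Implicit Arguments.
Unset Strict Implicit.
Unset Printing Implicit Defensive.
Import Order.TTheory GRing.Theory Num.Theory.
Import numFieldNormedType.Exports.
Local Open Scope classical_set_scope.
Local Open Scope ring_scope.

(** Why the theorem holds. Write [r = expR s] and collect the pairs [(s, A)] such
    that the field [X (r^E t)] has the finite-dimensional laws of
    [A *m X t + a t] for some non-random shift [a]. Composing two such identities
    adds the times and multiplies the matrices, and properness makes every [A]
    invertible, so these pairs form a group that projects onto the line. The
    exponent [D] is a one-parameter subgroup [s |-> (s, exp (s D))] that splits
    this projection.

    Such a splitting exists because the group is closed with compact fibres,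
    locally uniformly in [s] (lemma [scaling_compact]). That is the convergence of
    types theorem, [convergence_of_types]: if [A_i Z + c_i] has the law of a family
    that converges in probability, and the law of [Z] is full, then [A_i] and
    [c_i] converge along ultrafilters; otherwise dividing by the norm of [A_i]
    would give in the limit a nonzero matrix that maps [Z] to a constant. The
    splitting itself, [one_parameter_section], is von Neumann's tangent argument:
    the fibre elements closest to the identity over times tending to 0 have
    bounded difference quotients, for otherwise a tangent direction of the fibre
    over 0 could be used to bring them closer.

    The spectral claims only depend on [exp (s D)] for [s] tending to minus
    infinity. As [E] has its spectrum in the open right half-plane, [exp (s E)]
    tends to 0 there ([mexp_decay]), so [X (exp (s E) t)] tends to [X 0]. By
    convergence of types [exp (s D)] stays bounded, which forces the condition
    [Mmx D] ([bounded_mexp_Mmx]), and its limit points map the full law of [X t]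
    to that of [X 0] up to a shift. Hence [exp (s D)] tends to 0 when [X 0] is
    constant; conversely, if it tends to 0 the law of [X 0] is a limit of point
    masses. That [exp (s D)] tends to 0 is equivalent to [Qmx D] ([mexp_decay] and
    [mexp_decay_Qmx]). The eigenvalues are complex but the exponential is real:
    the real and imaginary parts of eigenvectors solve planar linear systems
    whose squared radius obeys a scalar differential (in)equality.

    Continuity of the shifts is soft: limit points exist by tightness and are
    unique because the law of a random vector determines a translation of it
    ([eq_law_shift_inj]); near scale 0 the only possible limit is the constant
    value of [X 0]. *)

(** * Ultrafilters *)

Lemma ultra_fmap (I J : Type) (f : I -> J) (U : set_system I) :
  UltraFilter U -> UltraFilter (f @ U).
Proof.
move=> UU; split; first exact: fmap_proper_filter.
move=> G GG UG; apply/seteqP; split => // A GA.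
have [//|] := in_ultra_setVsetC (f @^-1` A) UU.
move=> /(UG (~` A)) GnA.
by have /filter_ex[x []] : G (A `&` ~` A) by exact: filterI.
Qed.

(** A neighbourhood whose preimage is not in [F] leaves room for an ultrafilter
    finer than [F] that contains the complement of that preimage. *)
Lemma ultra_cvgP (I : Type) (T : topologicalType) (F : set_system I)
    (f : I -> T) (l : T) : Filter F ->
  (forall U : set_system I, UltraFilter U -> F `<=` U -> f @ U --> l) ->
  f @ F --> l.
Proof.
move=> FF h A lA; apply: contrapT => nFA.
have pF : ProperFilter (within (~` (f @^-1` A)) F).
  apply: Build_ProperFilter => FN; apply: nFA.
  rewrite /within/= in FN; apply: filterS FN => x /=.
  by move=> /contrapT.
have [U [UU FU]] := ultraFilterLemma pF.
have UF : F `<=` U.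
  by move=> B FB; apply: FU; rewrite /within /=; apply: filterS FB => x Bx _.
have UA : U (f @^-1` A) by exact: h UU UF A lA.
have UnA : U (~` (f @^-1` A)).
  by apply: FU; rewrite /within /=; exact: filterE.
by have /filter_ex[x []] : U (f @^-1` A `&` ~` (f @^-1` A)) by exact: filterI.
Qed.

Lemma ultra_unbounded (R : realType) (I : Type) (U : set_system I)
    (f : I -> R) : UltraFilter U ->
  (exists K, \forall i \near U, f i <= K) \/
  (forall K, \forall i \near U, K < f i).
Proof.
move=> UU; have [?|nb] := pselect (exists K, \forall i \near U, f i <= K).
  by left.
right=> K; have [UK|] := in_ultra_setVsetC [set i | f i <= K] UU.
  by exfalso; apply: nb; exists K.
by apply: filterS => i /= /negP; rewrite -ltNge.
Qed.

Lemma ultra_real_cvg (R : realType) (I : Type) (U : set_system I)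
    (f : I -> R) (K : R) : UltraFilter U ->
  (\forall i \near U, `|f i| <= K) -> exists a : R, f @ U --> a.
Proof.
move=> UU fK; have := @segment_compact R (- K) K; rewrite compact_ultra.
move=> /(_ (f @ U) (ultra_fmap f UU)) [|a [_ fa]]; last by exists a.
by apply: filterS fK => i /=; rewrite in_itv/= ler_norml.
Qed.

(** * Convergence of matrices *)

Section MatrixCvg.
Variables (R : realType).

Lemma mx_entry_le m n (A : 'M[R]_(m, n)) i j : `|A i j| <= `|A|.
Proof.
rewrite [leRHS]/Num.Def.normr/= mx_normrE.
by apply/bigmax_geP; right => /=; exists (i, j).
Qed.

Lemma mx_norm_le m n (A : 'M[R]_(m, n)) c : 0 <= c ->
  (forall i j, `|A i j| <= c) -> `|A| <= c.
Proof.
move=> c0 Ac; rewrite [leLHS]/Num.Def.normr/= mx_normrE.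
by apply/bigmax_leP; split => // -[i j] _ /=.
Qed.

Lemma mulmx_norm m n p (A : 'M[R]_(m, n)) (B : 'M[R]_(n, p)) :
  `|A *m B| <= n%:R * `|A| * `|B|.
Proof.
apply: mx_norm_le; first by rewrite !mulr_ge0.
move=> i j; rewrite mxE (le_trans (ler_norm_sum _ _ _))//.
have -> : n%:R * `|A| * `|B| = \sum_(k < n) `|A| * `|B|.
  by rewrite sumr_const card_ord -mulrA mulr_natl.
by rewrite ler_sum// => k _; rewrite normrM ler_pM ?mx_entry_le.
Qed.

Lemma mx_cvgP m n (I : Type) (F : set_system I) (f : I -> 'M[R]_(m, n))
    (A : 'M[R]_(m, n)) : Filter F ->
  f @ F --> A <-> forall i j, (fun x => f x i j) @ F --> A i j.
Proof.
move=> FF; split=> [fA i j|fA].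
  exact: (@cvg_comp _ _ _ f (fun M : 'M[R]_(m, n) => M i j) _ _ _ fA
            (@coord_continuous _ _ _ i j A)).
apply/cvgrPdist_le => e e0.
have : \forall x \near F, forall ij : 'I_m * 'I_n,
    `|A ij.1 ij.2 - f x ij.1 ij.2| <= e.
  apply: filter_forall => -[i j] /=.
  by have /cvgrPdist_le/(_ _ e0) := fA i j.
apply: filterS => x Ax; apply: mx_norm_le; first exact: ltW.
by move=> i j; rewrite !mxE; exact: (Ax (i, j)).
Qed.

Lemma mulmx_cvg m n p (I : Type) (F : set_system I) (f : I -> 'M[R]_(m, n))
    (g : I -> 'M[R]_(n, p)) (A : 'M[R]_(m, n)) (B : 'M[R]_(n, p)) : Filter F ->
  f @ F --> A -> g @ F --> B -> (fun x => f x *m g x) @ F --> A *m B.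
Proof.
move=> FF /mx_cvgP fA /mx_cvgP gB; apply/mx_cvgP => i j.
rewrite mxE; under eq_fun do rewrite mxE.
apply: (@cvg_big _ _ _ _ _ add_continuous) => k _; exact: cvgM.
Qed.

(** Along an ultrafilter boundedness is all that a limit requires; this replaces
    every extraction of subsequences below, including simultaneous ones over
    uncountably many indices. *)
Lemma ultra_mx_cvg m n (I : Type) (U : set_system I) (f : I -> 'M[R]_(m, n))
    (K : R) : UltraFilter U ->
  (\forall i \near U, `|f i| <= K) -> exists A : 'M[R]_(m, n), f @ U --> A.
Proof.
move=> UU fK.
have /choice[a fa] : forall ij : 'I_m * 'I_n, exists a : R,
    (fun x => f x ij.1 ij.2) @ U --> a.
  move=> ij; apply: (@ultra_real_cvg _ _ _ _ K UU).
  by apply: filterS fK => x; apply: le_trans; exact: mx_entry_le.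
exists (\matrix_(i, j) a (i, j)); apply/mx_cvgP => i j.
by rewrite mxE; exact: (fa (i, j)).
Qed.

End MatrixCvg.

(** * The exponential of a matrix *)

Section MatrixExp.
Variables (R : realType) (n : nat).
Implicit Types (A B : 'M[R]_n) (s t : R).

(** The entries of [B *m exp (s A)] are power series in [s]; carrying the
    left factor [B] makes this family of coefficients stable under formal
    differentiation. *)
Definition mexp_coeff B A (i j : 'I_n) (k : nat) : R :=
  (B *m A ^+ k) i j / k`!%:R.

Definition mexp A s : 'M[R]_n :=
  limn (series (fun k : nat => (s ^+ k / k`!%:R) *: A ^+ k)).

Lemma mxpow_norm A k : `|A ^+ k| <= (n%:R * `|A| + 1) ^+ k.
Proof.
elim: k => [|k IH].
  rewrite expr0; apply: mx_norm_le => // i j.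
  by rewrite -[1]/(1%:M) mxE normr_nat lern1; case: (_ == _).
rewrite !exprS -mulmxE (le_trans (mulmx_norm _ _))// ler_pM ?mulr_ge0//.
by rewrite lerDl.
Qed.

Lemma is_cvg_mexp_coeff B A i j s : cvgn (pseries (mexp_coeff B A i j) s).
Proof.
set c := n%:R * `|A| + 1; have c0 : 0 <= c by rewrite addr_ge0// mulr_ge0.
set K := n%:R * `|B|; have K0 : 0 <= K by rewrite mulr_ge0.
apply: normed_cvg.
apply: (@series_le_cvg _ _ (fun k => K * exp_coeff (c * `|s|) k)) => [k|k|k|].
- by rewrite normr_ge0.
- by rewrite mulr_ge0// exp_coeff_ge0// mulr_ge0.
- have -> : K * exp_coeff (c * `|s|) k = (K * c ^+ k) / k`!%:R * `|s| ^+ k.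
    by rewrite /exp_coeff/= exprMn; ring.
  rewrite /mexp_coeff/= !normrM normfV (ger0_norm (ler0n _ _)) normrX.
  rewrite ler_wpM2r ?exprn_ge0// ler_wpM2r//.
  apply: le_trans (mx_entry_le _ _ _) _; apply: le_trans (mulmx_norm _ _) _.
  by rewrite ler_wpM2l// mxpow_norm.
- by apply: is_cvg_seriesZ; exact: is_cvg_series_exp_coeff.
Qed.

Lemma mexp_cvg A s :
  series (fun k : nat => (s ^+ k / k`!%:R) *: A ^+ k) @ \oo --> mexp A s.
Proof.
apply: (@cvgP _ _ (\matrix_(i, j) limn (pseries (mexp_coeff 1%:M A i j) s))).
apply/mx_cvgP => i j; rewrite mxE.
rewrite (_ : (fun x => _) = pseries (mexp_coeff 1%:M A i j) s).
  exact: is_cvg_mexp_coeff.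
apply/funext => k; rewrite /series/= summxE; apply: eq_bigr => l _.
by rewrite mxE /mexp_coeff/= mul1mx; ring.
Qed.

Lemma mexp_coeff_lim B A i j s :
  limn (pseries (mexp_coeff B A i j) s) = (B *m mexp A s) i j.
Proof.
apply/cvg_lim => //.
have /mx_cvgP/(_ i j) : (fun k => B *m series
    (fun k : nat => (s ^+ k / k`!%:R) *: A ^+ k) k) @ \oo --> B *m mexp A s.
  by apply: mulmx_cvg; [exact: cvg_cst|exact: mexp_cvg].
apply: cvg_trans; apply: near_eq_cvg; near=> k.
rewrite /pseries /series/= mulmx_sumr summxE; apply: eq_bigr => l _.
by rewrite -scalemxAr mxE /mexp_coeff/=; ring.
Unshelve. all: by end_near. Qed.

Lemma mexp_derive A s i j :
  is_derive s (1 : R) (fun s => mexp A s i j) ((A *m mexp A s) i j).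
Proof.
have diffs B : pseries_diffs (mexp_coeff B A i j) = mexp_coeff (B *m A) A i j.
  apply/funext => k; rewrite /pseries_diffs /mexp_coeff factS natrM exprS.
  by rewrite -mulmxE mulmxA invfM mulrCA mulVKf.
rewrite (_ : (fun s => _) = fun s => limn (pseries (mexp_coeff 1%:M A i j) s)).
  rewrite -[A in A *m _]mul1mx -mexp_coeff_lim -diffs.
  by apply: (@pseries_snd_diffs _ _ (`|s| + 1)); rewrite ?diffs;
     do ?exact: is_cvg_mexp_coeff; rewrite [ltRHS]ger0_norm ?ltrDl.
by apply/funext => u; rewrite mexp_coeff_lim mul1mx.
Qed.

End MatrixExp.

(** * Matrix-valued functions of one real variable *)

Section MatrixDerive.
Variable R : realType.

Definition mx_is_derive m n (F F' : R -> 'M[R]_(m, n)) : Prop :=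
  forall s i j, is_derive s (1 : R) (fun u => F u i j) (F' s i j).

Lemma mx_is_derive_cst m n (C : 'M[R]_(m, n)) :
  mx_is_derive (fun=> C) (fun=> 0).
Proof. by move=> s i j; rewrite mxE; exact: is_derive_cst. Qed.

Lemma mx_is_derive_mul m n p (F F' : R -> 'M[R]_(m, n))
    (G G' : R -> 'M[R]_(n, p)) :
  mx_is_derive F F' -> mx_is_derive G G' ->
  mx_is_derive (fun s => F s *m G s) (fun s => F' s *m G s + F s *m G' s).
Proof.
move=> dF dG s i j.
rewrite (_ : (fun u => _) =
    \sum_(k < n) ((fun u => F u i k) * (fun u => G u k j))); last first.
  by apply/funext => u; rewrite mxE fct_sumE; apply: eq_bigr.
apply: is_derive_eq.
  by apply: is_derive_sum => k; apply: is_deriveM; [exact: dF|exact: dG].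
rewrite !mxE -big_split/=; apply: eq_bigr => k _.
by rewrite addrC; congr (_ + _); rewrite mulrC.
Qed.

Lemma mx_is_derive_comp m n (F F' : R -> 'M[R]_(m, n)) (g : R -> R) (b : R) :
  mx_is_derive F F' -> (forall s, is_derive s (1 : R) g b) ->
  mx_is_derive (fun s => F (g s)) (fun s => b *: F' (g s)).
Proof.
move=> dF dg s i j; rewrite mxE mulrC.
exact: (@is_derive1_comp _ (fun u => F u i j) g).
Qed.

Lemma mx_is_derive0_cst m n (F : R -> 'M[R]_(m, n)) (s t : R) :
  mx_is_derive F (fun=> 0) -> F s = F t.
Proof.
move=> dF; apply/matrixP => i j.
apply: (@is_derive_0_is_cst _ (fun u => F u i j)) => u.
by have := dF u i j; rewrite mxE.
Qed.

Lemma mx_is_derive_cts m n (F F' : R -> 'M[R]_(m, n)) :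
  mx_is_derive F F' -> continuous F.
Proof.
move=> dF s; apply/mx_cvgP => i j.
have [d _] := dF s i j.
have : {for s, continuous (fun u => F u i j)}.
  exact/differentiable_continuous/derivable1_diffP.
by [].
Qed.

End MatrixDerive.

Section MatrixExpTheory.
Variables (R : realType) (n : nat).
Implicit Types (A B : 'M[R]_n) (s t : R).

Lemma mexp0 A : mexp A 0 = 1%:M.
Proof.
(* the empty partial sum is skipped: all the others equal the identity *)
apply: cvg_lim => //; rewrite -cvg_shiftS; apply: cvg_near_cst; near=> k.
rewrite /series/= big_nat_recl//= big1 ?addr0.
  by rewrite !expr0 fact0 divr1 scale1r.
by move=> l _; rewrite expr0n mul0r scale0r.
Unshelve. all: by end_near. Qed.

Lemma mexp_is_derive A : mx_is_derive (mexp A) (fun s => A *m mexp A s).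
Proof. by move=> s i j; exact: mexp_derive. Qed.

Lemma mexp_cts A : continuous (mexp A).
Proof. exact: mx_is_derive_cts (mexp_is_derive A). Qed.

Lemma mexp_comm A s : mexp A s *m A = A *m mexp A s.
Proof.
set S := series (fun k : nat => (s ^+ k / k`!%:R) *: A ^+ k).
have SA : (fun k => S k *m A) @ \oo --> mexp A s *m A.
  by apply: mulmx_cvg; [exact: mexp_cvg|exact: cvg_cst].
have AS : (fun k => A *m S k) @ \oo --> A *m mexp A s.
  by apply: mulmx_cvg; [exact: cvg_cst|exact: mexp_cvg].
have SE : (fun k => S k *m A) = (fun k => A *m S k).
  apply/funext => k; rewrite /S/series/= mulmx_suml mulmx_sumr.
  by apply: eq_bigr => l _; rewrite -scalemxAl -scalemxAr !mulmxE -exprS -exprSr.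
rewrite SE in SA.
by apply: (cvg_unique _ SA AS); exact: norm_hausdorff.
Qed.

(** For fixed [v] the product [mexp A (v + u) *m mexp A (- u)] has zero derivative
    in [u], hence keeps its value [mexp A v] at 0. *)
Lemma mexpD A s t : mexp A (s + t) = mexp A s *m mexp A t.
Proof.
have dE := mexp_is_derive A.
have dN : mx_is_derive (fun u => mexp A (- u))
    (fun u => -1 *: (A *m mexp A (- u))).
  have dopp (u : R) : is_derive u (1 : R) (fun u => - u) (- 1).
    exact: (is_deriveN (is_derive_id u (1 : R))).
  exact: mx_is_derive_comp dE dopp.
have dD (v : R) : mx_is_derive (fun u => mexp A (v + u))
    (fun u => 1 *: (A *m mexp A (v + u))).
  have dadd (u : R) : is_derive u (1 : R) (fun u => v + u) 1.
    rewrite -[X in is_derive _ _ _ X]add0r.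
    exact: (is_deriveD (is_derive_cst v u (1 : R)) (is_derive_id u (1 : R))).
  exact: mx_is_derive_comp dE dadd.
have K v u : mexp A (v + u) *m mexp A (- u) = mexp A v.
  rewrite (@mx_is_derive0_cst _ _ _ (fun u => mexp A (v + u) *m mexp A (- u)) u 0).
    by rewrite addr0 oppr0 mexp0 mulmx1.
  rewrite (_ : (fun=> 0) = fun u => (1 *: (A *m mexp A (v + u))) *m mexp A (- u)
      + mexp A (v + u) *m (-1 *: (A *m mexp A (- u)))).
    exact: mx_is_derive_mul.
  apply/funext => w; rewrite scale1r scaleN1r mulmxN mulmxA mexp_comm.
  by rewrite subrr.
have K0 u : mexp A (- u) *m mexp A u = 1%:M.
  by have := K 0 (- u); rewrite add0r opprK mexp0.
by rewrite -(K s t) -mulmxA K0 mulmx1.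
Qed.

Lemma mexpNK A s : mexp A (- s) *m mexp A s = 1%:M.
Proof. by rewrite -mexpD addNr mexp0. Qed.

Lemma mexpKN A s : mexp A s *m mexp A (- s) = 1%:M.
Proof. by rewrite -mexpD addrN mexp0. Qed.

Lemma mexpMn A s k : mexp A (s *+ k) = mexp A s ^+ k.
Proof.
elim: k => [|k IH]; first by rewrite mulr0n mexp0 expr0.
by rewrite mulrS mexpD IH exprS mulmxE.
Qed.

Lemma mexp_slope A (I : Type) (F : set_system I) (e : I -> R) : Filter F ->
  (\forall i \near F, e i != 0) -> e @ F --> 0 ->
  (fun i => (e i)^-1 *: (mexp A (e i) - 1%:M)) @ F --> A.
Proof.
move=> FF e0 eF; apply/mx_cvgP => i j.
have [d dE] := mexp_derive A 0 i j.
rewrite mexp0 mulmx1 in dE; rewrite -dE.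
have ed : e @ F --> 0^'.
  move=> V /(eF _); rewrite /= /nbhs/=.
  by apply: filterS2 e0 => k ek; apply.
apply: cvg_trans (cvg_comp _ _ ed d); apply: near_eq_cvg; near=> k.
by rewrite /= !mxE scaler1 addr0 mexp0 mxE.
Unshelve. all: by end_near. Qed.

End MatrixExpTheory.

(** * Powers of matrices close to the identity *)

Section RowBound.
Variables (R : realType) (n : nat).
Implicit Types (A B : 'M[R]_n).

(** A bound on the operator norm subordinate to the sup norm of vectors; unlike
    the entrywise norm it is submultiplicative and equals 1 at the identity, so
    that it survives taking high powers. *)
Definition rowbnd A (c : R) : Prop := forall i, \sum_j `|A i j| <= c.

Lemma rowbnd_mul A B a b : 0 <= b ->
  rowbnd A a -> rowbnd B b -> rowbnd (A *m B) (a * b).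
Proof.
move=> b0 Aa Bb i.
apply: (@le_trans _ _ (\sum_j \sum_k `|A i k| * `|B k j|)).
  apply: ler_sum => j _; rewrite mxE (le_trans (ler_norm_sum _ _ _))//.
  by apply: ler_sum => k _; rewrite normrM.
rewrite exchange_big/= (@le_trans _ _ (\sum_k `|A i k| * b))//.
  by apply: ler_sum => k _; rewrite -mulr_sumr ler_wpM2l.
by rewrite -mulr_suml ler_wpM2r.
Qed.

Lemma rowbnd_add A B a b :
  rowbnd A a -> rowbnd B b -> rowbnd (A + B) (a + b).
Proof.
move=> Aa Bb i; rewrite (le_trans _ (lerD (Aa i) (Bb i)))// -big_split/=.
by apply: ler_sum => j _; rewrite mxE ler_normD.
Qed.

Lemma rowbnd1 : rowbnd 1%:M 1.
Proof.
move=> i; rewrite (bigD1 i)//= mxE eqxx normr1 big1 ?addr0// => j ji.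
by rewrite mxE eq_sym (negbTE ji) normr0.
Qed.

Lemma rowbnd_scale e A a : rowbnd A a -> rowbnd (e *: A) (`|e| * a).
Proof.
move=> Aa i; rewrite (le_trans _ (ler_wpM2l (normr_ge0 e) (Aa i)))// mulr_sumr.
by apply: ler_sum => j _; rewrite mxE normrM.
Qed.

Lemma rowbnd_norm A : rowbnd A (n%:R * `|A|).
Proof.
move=> i; have -> : n%:R * `|A| = \sum_(k < n) `|A|.
  by rewrite sumr_const card_ord mulr_natl.
by apply: ler_sum => j _; exact: mx_entry_le.
Qed.

Lemma norm_rowbnd A a : 0 <= a -> rowbnd A a -> `|A| <= a.
Proof.
move=> a0 Aa; apply: mx_norm_le => // i j; apply: le_trans (Aa i).
by rewrite (bigD1 j)//= lerDl sumr_ge0.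
Qed.

Lemma rowbnd_pow A a k : 0 <= a -> rowbnd A a -> rowbnd (A ^+ k) (a ^+ k).
Proof.
move=> a0 Aa; elim: k => [|k IH]; first by rewrite !expr0; exact: rowbnd1.
by rewrite !exprS; apply: rowbnd_mul => //; exact: exprn_ge0.
Qed.

(** The difference of two powers telescopes into [k] terms, each of them a product
    of [A - B] with [k - 1] factors of norm at most [a]. *)
Lemma rowbnd_pow_diff A B a e k : 1 <= a -> 0 <= e ->
  rowbnd A a -> rowbnd B a -> rowbnd (A - B) e ->
  rowbnd (A ^+ k - B ^+ k) (k%:R * a ^+ k * e).
Proof.
move=> a1 e0 Aa Ba ABe; have a0 : 0 <= a := le_trans ler01 a1.
elim: k => [|k IH].
  by move=> i; rewrite !expr0 subrr big1 ?mul0r// => j _; rewrite mxE normr0.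
have -> : A ^+ k.+1 - B ^+ k.+1 = A * (A ^+ k - B ^+ k) + (A - B) * B ^+ k.
  by rewrite mulrBr mulrBl !exprS addrA subrK.
move=> i; apply: le_trans (rowbnd_add (rowbnd_mul _ Aa IH)
  (rowbnd_mul _ ABe (rowbnd_pow k a0 Ba)) i) _.
- by rewrite !mulr_ge0// exprn_ge0.
- exact: exprn_ge0.
rewrite -natr1 !mulrDl mul1r lerD//.
  by rewrite exprS [leRHS](_ : _ = a * (k%:R * a ^+ k * e))//; ring.
by rewrite mulrC ler_wpM2r// exprS ler_peMl// exprn_ge0.
Qed.

End RowBound.

Section PowLimit.
Variables (R : realType) (n : nat) (I : Type) (F : set_system I).
Context {FF : ProperFilter F}.
Implicit Types (H K : I -> 'M[R]_n) (L : 'M[R]_n).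

(** Each step has norm at most [1 + e i * c <= expR (e i * c)], so [k i] of them
    stay bounded while the [k i] errors, each [o(e i)], add up to [o(1)]. *)
Lemma pow_near_identity (e : I -> R) (k : I -> nat) H K L (tau : R) :
  (\forall i \near F, 0 < e i) -> (\forall i \near F, (k i)%:R * e i <= tau) ->
  H @ F --> L -> K @ F --> L ->
  (fun i => (1%:M + e i *: H i) ^+ k i - (1%:M + e i *: K i) ^+ k i) @ F -->
    (0 : 'M[R]_n).
Proof.
move=> e0 ke HL KL.
set c := n%:R * (`|L| + 1); have c0 : 0 <= c by rewrite mulr_ge0// addr_ge0.
have near_rowbnd (J : I -> 'M[R]_n) : J @ F --> L ->
    \forall i \near F, rowbnd (1%:M + e i *: J i) (1 + e i * c).
  move=> JL; have JL1 : \forall i \near F, `|J i| <= `|L| + 1.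
    move/cvgrPdist_le : JL => /(_ _ ltr01); apply: filterS => i h.
    by rewrite -lerBlDl (le_trans _ h)// distrC (le_trans (lerB_dist _ _)).
  apply: filterS2 e0 JL1 => i ei0 JiL.
  apply: rowbnd_add; first exact: rowbnd1.
  rewrite -[in e i * c](gtr0_norm ei0); apply: rowbnd_scale => l.
  by rewrite (le_trans (rowbnd_norm (J i) l))// ler_wpM2l.
have HK : (fun i => tau * expR (c * tau) * n%:R * `|H i - K i|) @ F --> 0.
  rewrite -(mulr0 (tau * expR (c * tau) * n%:R)); apply: cvgM; first exact: cvg_cst.
  by apply/norm_cvg0P; rewrite -(subrr L); exact: cvgB.
apply/cvgr0Pnorm_le => eps eps0.
have HKe : \forall i \near F,
    `|tau * expR (c * tau) * n%:R * `|H i - K i| | <= eps.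
  by move/cvgr0Pnorm_le : HK; apply.
have Hb := near_rowbnd _ HL; have Kb := near_rowbnd _ KL.
near=> i => /=.
have ei0 : 0 < e i by near: i.
have ki : (k i)%:R * e i <= tau by near: i.
have tau0 : 0 <= tau by rewrite (le_trans _ ki)// mulr_ge0// ltW.
have a1 : 1 <= 1 + e i * c by rewrite lerDl mulr_ge0// ltW.
have ak : (1 + e i * c) ^+ k i <= expR (c * tau).
  apply: (@le_trans _ _ (expR (e i * c) ^+ k i)).
    by rewrite lerXn2r ?nnegrE ?expR_ge0 ?expR_ge1Dx// (le_trans ler01).
  by rewrite -expRM_natl ler_expR mulrA mulrC ler_wpM2l.
have d : rowbnd ((1%:M + e i *: H i) - (1%:M + e i *: K i))
    (e i * (n%:R * `|H i - K i|)).
  rewrite opprD addrACA subrr add0r -scalerBr -[in X in rowbnd _ X](gtr0_norm ei0).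
  by apply: rowbnd_scale; exact: rowbnd_norm.
have Hi : rowbnd (1%:M + e i *: H i) (1 + e i * c) by near: i.
have Ki : rowbnd (1%:M + e i *: K i) (1 + e i * c) by near: i.
have d0 : 0 <= e i * (n%:R * `|H i - K i|) by rewrite !mulr_ge0// ltW.
have dk := rowbnd_pow_diff (k i) a1 d0 Hi Ki d.
apply: le_trans (norm_rowbnd _ dk) _.
  by rewrite !mulr_ge0 ?exprn_ge0 ?(ltW ei0)// (le_trans ler01).
have -> : (k i)%:R * (1 + e i * c) ^+ k i * (e i * (n%:R * `|H i - K i|)) =
  ((k i)%:R * e i) * (1 + e i * c) ^+ k i * n%:R * `|H i - K i| by ring.
have : `|tau * expR (c * tau) * n%:R * `|H i - K i| | <= eps by near: i.
apply: le_trans; apply: le_trans (ler_norm _).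
do 2 (apply: ler_wpM2r => //); apply: ler_pM => //.
- by rewrite mulr_ge0// ltW.
- by rewrite exprn_ge0// (le_trans ler01).
Unshelve. all: by end_near. Qed.

(** The steps [mexp L (e i)] have the same form [1 + e i *: K i] with [K] tending
    to [L], and their powers are known from the semigroup law. *)
Lemma pow_cvg_mexp (e : I -> R) (k : I -> nat) H L (t : R) :
  (\forall i \near F, 0 < e i) -> e @ F --> 0 ->
  (fun i => (k i)%:R * e i) @ F --> t -> H @ F --> L ->
  (fun i => (1%:M + e i *: H i) ^+ k i) @ F --> mexp L t.
Proof.
move=> e0 eF ket HL.
have en0 : \forall i \near F, e i != 0 by apply: filterS e0 => i /gt_eqF ->.
set K := fun i => (e i)^-1 *: (mexp L (e i) - 1%:M).
have KL : K @ F --> L by exact: mexp_slope.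
have ket1 : \forall i \near F, (k i)%:R * e i <= t + 1.
  move/cvgrPdist_le : ket => /(_ _ ltr01); apply: filterS => i.
  by rewrite ler_distlC => /andP[].
have := pow_near_identity e0 ket1 HL KL.
have KE : (fun i => (1%:M + e i *: K i) ^+ k i) @ F --> mexp L t.
  apply: cvg_trans (cvg_comp _ _ ket (@mexp_cts _ _ L t)).
  apply: near_eq_cvg; apply: filterS en0 => i ei /=.
  by rewrite /K scalerA mulfV// scale1r addrC subrK mulr_natl mexpMn.
move=> /cvgD/(_ KE); rewrite add0r; apply: cvg_trans.
by apply: near_eq_cvg; near=> i; rewrite /= subrK.
Unshelve. all: by end_near. Qed.

End PowLimit.

(** * One-parameter sections of closed matrix groups *)

Section OneParameterSection.
Variables (R : realType) (n : nat) (G : R -> 'M[R]_n -> Prop).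
Hypothesis G_mul : forall s t A B, G s A -> G t B -> G (s + t) (A *m B).
Hypothesis G_inv : forall s A, G s A -> A \in unitmx /\ G (- s) (invmx A).
Hypothesis G_ex : forall s, exists A, G s A.
Hypothesis G_compact : forall (U : set_system nat) (s : nat -> R)
    (A : nat -> 'M[R]_n) (sigma : R), UltraFilter U -> s @ U --> sigma ->
  (forall k, G (s k) (A k)) -> exists2 B, A @ U --> B & G sigma B.

Let G01 : G 0 1%:M.
Proof.
have [A GA] := G_ex 0; have [uA GA'] := G_inv GA.
by have := G_mul GA GA'; rewrite mulmxV// subrr.
Qed.

Let G_pow s A k : G s A -> G (s *+ k) (A ^+ k).
Proof.
move=> GA; elim: k => [|k IH]; first exact: G01.
by rewrite mulrS exprS -mulmxE; exact: G_mul.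
Qed.

(** Take [truncn (t / e k)] steps along [A k]: the matrices tend to [mexp L t]
    while the time elapsed, [s k] per step, tends to [sigma * t]. Both regimes of
    the next proof are instances, with [sigma] equal to 1 and to 0. *)
Let G_tangent (U : set_system nat) (s e : nat -> R) (A : nat -> 'M[R]_n)
    (L : 'M[R]_n) (sigma t : R) : UltraFilter U ->
  (forall k, G (s k) (A k)) -> (\forall k \near U, 0 < e k) -> e @ U --> 0 ->
  (fun k => s k / e k) @ U --> sigma ->
  (fun k => (e k)^-1 *: (A k - 1%:M)) @ U --> L ->
  0 <= t -> G (sigma * t) (mexp L t).
Proof.
move=> UU GA e0 eU seU HL t0.
pose q k := Num.truncn (t / e k).
have qe : (fun k => (q k)%:R * e k) @ U --> t.
  have te : (fun k => t - e k) @ U --> t.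
    by rewrite -[X in _ --> X]subr0; apply: cvgB => //; exact: cvg_cst.
  apply: (squeeze_cvgr _ te (cvg_cst t)).
  apply: filterS e0 => k ek0.
  have /truncn_itv/andP[h1 h2] : 0 <= t / e k by rewrite divr_ge0// ltW.
  rewrite -/(q k) in h1 h2.
  move: h1; rewrite ler_pdivlMr// => ->; rewrite andbT.
  move: h2; rewrite ltr_pdivrMr// -natr1 mulrDl mul1r => h2.
  by rewrite lerBlDr ltW.
have sq : (fun k => s k *+ q k) @ U --> sigma * t.
  apply: cvg_trans (cvgM seU qe); apply: near_eq_cvg.
  apply: filterS e0 => k ek0 /=.
  by rewrite -mulr_natr; field; rewrite gt_eqF.
have Aq : (fun k => A k ^+ q k) @ U --> mexp L t.
  apply: cvg_trans (pow_cvg_mexp e0 eU qe HL); apply: near_eq_cvg.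
  apply: filterS e0 => k ek0 /=.
  by rewrite scalerA mulfV ?gt_eqF// scale1r addrC subrK.
have [B AB GB] := G_compact UU sq (fun k => G_pow (q k) (GA k)).
by rewrite (cvg_unique _ Aq AB)//; exact: norm_hausdorff.
Qed.

(** Choose [A k] over time [s k = 1 / (k + 1)], almost as close to the identity as
    possible, at distance [e k]. If [e k / s k] is bounded, [D] is the limit of
    the difference quotients. Otherwise the normalized displacements converge to
    a unit matrix [L] whose whole one-parameter group lies over time 0, so that
    [A k *m mexp L (- e k)] also lies over [s k]; it is at distance [o(e k)] from
    the identity, against the choice of [A k]. *)
Lemma one_parameter_section : exists D : 'M[R]_n, forall s, G s (mexp D s).
Proof.
pose s (k : nat) : R := k.+1%:R^-1.
have s0 k : 0 < s k by rewrite invr_gt0.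
have [U [UU ooU]] := @ultraFilterLemma nat \oo _.
have sU : s @ U --> 0 by move=> V /cvg_harmonic; exact: ooU.
have [A GA Amin] : exists2 A : nat -> 'M[R]_n, forall k, G (s k) (A k) &
    forall k A', G (s k) A' -> `|A k - 1%:M| <= `|A' - 1%:M| + s k.
  have /choice[A hA] : forall k, exists A : 'M[R]_n, G (s k) A /\
      forall A', G (s k) A' -> `|A - 1%:M| <= `|A' - 1%:M| + s k.
    move=> k; pose S := [set `|A - 1%:M| | A in G (s k)].
    have lbS : has_lbound S by exists 0 => _ [A _ <-].
    have infS : has_inf S.
      by split => //; have [A GA] := G_ex (s k); exists `|A - 1%:M|, A.
    have [_ [A GA <-] AS] := inf_adherent (s0 k) infS.
    exists A; split => // A' GA'; apply: (le_trans (ltW AS)).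
    by rewrite lerD2r; apply: ge_inf => //; exists A'.
  by exists A => k; have [] := hA k.
pose e k := `|A k - 1%:M|.
(* any selection of the fibres can be translated so as to tend to the identity *)
have eU : e @ U --> 0.
  have /choice[B GB] : forall k, exists B, G (s k) B by move=> k; exact: G_ex.
  have [B0 BB0 GB0] := G_compact UU sU GB.
  have [uB0 GB0'] := G_inv GB0; rewrite oppr0 in GB0'.
  have CU : (fun k => `|B k *m invmx B0 - 1%:M| + s k) @ U --> 0.
    rewrite -[X in _ --> X]addr0; apply: cvgD => //.
    apply/norm_cvg0P; rewrite -(subrr 1%:M); apply: cvgB; last exact: cvg_cst.
    by rewrite -(mulmxV uB0); apply: mulmx_cvg => //; exact: cvg_cst.
  apply: (squeeze_cvgr _ (cvg_cst 0) CU); apply: nearW => k.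
  rewrite /e normr_ge0/=; apply: Amin.
  by have := G_mul (GB k) GB0'; rewrite addr0.
have [[K eK]|eK] := ultra_unbounded (fun k => e k / s k) UU.
  have [D HD] : exists D : 'M[R]_n, (fun k => (s k)^-1 *: (A k - 1%:M)) @ U --> D.
    apply: (ultra_mx_cvg (K := K) UU); apply: filterS eK => k.
    by rewrite normrZ mulrC ger0_norm// invr_ge0 ltW.
  have ss : (fun k => s k / s k) @ U --> (1 : R).
    apply: cvg_near_cst; apply: nearW => k.
    by rewrite mulfV// gt_eqF.
  have GD t : 0 <= t -> G t (mexp D t).
    move=> t0; rewrite -[X in G X]mul1r; apply: (G_tangent UU GA _ sU ss HD) => //.
    exact: nearW.
  exists D => t; have [/GD//|t0] := leP 0 t.
  have /GD/G_inv[uD] : 0 <= - t by rewrite oppr_ge0 ltW.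
  rewrite opprK; congr G.
  by rewrite -[LHS]mulmx1 -(mexpNK D t) mulmxA mulVmx ?mul1mx.
exfalso.
have e0 : \forall k \near U, 0 < e k.
  by apply: filterS (eK 0) => k; rewrite pmulr_lgt0// invr_gt0.
have [L HL] : exists L : 'M[R]_n, (fun k => (e k)^-1 *: (A k - 1%:M)) @ U --> L.
  apply: (ultra_mx_cvg (K := 1) UU); apply: filterS e0 => k ek.
  by rewrite normrZ normfV ger0_norm ?normr_ge0// mulVf// gt_eqF.
have se : (fun k => s k / e k) @ U --> 0.
  apply/cvgr0Pnorm_le => eta eta0.
  apply: filterS2 e0 (eK eta^-1) => k ek eketa.
  rewrite normf_div (gtr0_norm (s0 k)) (gtr0_norm ek).
  rewrite ler_pdivrMr// mulrC -ler_pdivrMr// ltW//.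
  move: eketa; rewrite ltr_pdivlMr// => h.
  by rewrite ltr_pdivrMr// mulrC -ltr_pdivrMl// .
have GL0 t : G 0 (mexp L t).
  have GLp u : 0 <= u -> G 0 (mexp L u).
    by move=> u0; rewrite -[X in G X](mul0r u); exact: (G_tangent UU GA e0 eU se HL).
  have [/GLp//|t0] := leP 0 t.
  have /GLp/G_inv[uD] : 0 <= - t by rewrite oppr_ge0 ltW.
  rewrite oppr0; congr G.
  by rewrite -[LHS]mulmx1 -(mexpNK L t) mulmxA mulVmx ?mul1mx.
pose W k := (e k)^-1 *: (A k *m mexp L (- e k) - 1%:M).
have neU : (fun k => - e k) @ U --> 0 by rewrite -oppr0; exact: cvgN.
have WU : W @ U --> (0 : 'M[R]_n).
  have m1 : (fun k => mexp L (- e k)) @ U --> (1%:M : 'M[R]_n).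
    by rewrite -(mexp0 L); apply: (cvg_comp _ _ neU); exact: mexp_cts.
  have sl : (fun k => (- e k)^-1 *: (mexp L (- e k) - 1%:M)) @ U --> L.
    by apply: mexp_slope => //; apply: filterS e0 => k ek; rewrite oppr_eq0 gt_eqF.
  have HmL : (fun k => ((e k)^-1 *: (A k - 1%:M)) *m mexp L (- e k)) @ U --> L.
    by rewrite -[X in _ --> X]mulmx1; exact: mulmx_cvg.
  rewrite -(subrr L); apply: cvg_trans (cvgB HmL sl).
  apply: near_eq_cvg; apply: nearW => k.
  suff <- : (e k)^-1 *: (A k - 1%:M) *m mexp L (- e k)
      - (- e k)^-1 *: (mexp L (- e k) - 1%:M) = W k by [].
  rewrite /W invrN scaleNr opprK -scalemxAl mulmxBl mul1mx -scalerDr.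
  by rewrite addrA subrK.
have : (fun k => `|W k| + s k / e k) @ U --> 0.
  by rewrite -[X in _ --> X]addr0; apply: cvgD => //; apply/norm_cvg0P.
move=> /cvgrPdist_lt/(_ _ ltr01); rewrite near_simpl => small.
have [k [ek sk]] := filter_ex (filterI e0 small).
move: sk; rewrite /= sub0r normrN ltNge => /negP; apply.
apply: le_trans (ler_norm _).
have /Amin : G (s k) (A k *m mexp L (- e k)).
  by rewrite -[s k]addr0; exact: G_mul.
rewrite -/(e k) => h.
rewrite /W normrZ normfV (gtr0_norm ek) mulrC -mulrDl.
by rewrite ler_pdivlMr// mul1r.
Qed.

End OneParameterSection.

(** * Eigenvalues and the behaviour of the exponential at minus infinity *)

Lemma is_derive_expR_scale (R : realType) (c s : R) :
  is_derive s (1 : R) (fun s => expR (c * s)) (c * expR (c * s)).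
Proof.
have h : is_derive s (1 : R) (fun s => c * s) c.
  have := is_deriveZ c (is_derive_id s (1 : R)).
  by rewrite /GRing.scale/= mulr1.
rewrite mulrC.
exact: (@is_derive1_comp _ expR (fun s => c * s)).
Qed.

Section PlanarSystem.
Variables (R : realType) (a b : R) (x y x1 y1 : R -> R).
Hypothesis dx : forall s, is_derive s (1 : R) x (a * x s - b * y s + x1 s).
Hypothesis dy : forall s, is_derive s (1 : R) y (b * x s + a * y s + y1 s).

Let dg s : is_derive s (1 : R) (fun s => x s ^+ 2 + y s ^+ 2)
  (2 * a * (x s ^+ 2 + y s ^+ 2) + 2 * (x s * x1 s + y s * y1 s)).
Proof.
have hx := dx s; have hy := dy s.
rewrite (_ : (fun s => _) = x * x + y * y); last by apply/funext => u.
apply: is_derive_eq; rewrite /GRing.scale/=; ring.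
Qed.

(** Variation of constants for the squared radius: a forcing term that dies out
    cannot prevent an expanding system from contracting backwards in time. *)
Lemma planar_decay : 0 < a -> x1 s @[s --> -oo] --> 0 -> y1 s @[s --> -oo] --> 0 ->
  x s @[s --> -oo] --> 0 /\ y s @[s --> -oo] --> 0.
Proof.
move=> a0 x10 y10.
pose g s := x s ^+ 2 + y s ^+ 2.
have forcing : (fun s => (x1 s ^+ 2 + y1 s ^+ 2) / a) @ -oo --> 0.
  have -> : 0 = (0 ^+ 2 + 0 ^+ 2) / a :> R by rewrite expr0n/= addr0 mul0r.
  apply: cvgM; last exact: cvg_cst.
  by apply: cvgD; exact: cvgM.
have g0 : g @ -oo --> 0.
  apply/cvgr0Pnorm_le => eps eps0.
  pose eta := eps / 2; have eta0 : 0 < eta by rewrite divr_gt0.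
  have /cvgr0Pnorm_le/(_ _ (mulr_gt0 a0 eta0)) := forcing.
  move=> [s0 [_ s0P]].
  have [s1 s1s0 fs1] : exists2 s1, s1 < s0 & forall s, s <= s1 ->
      (x1 s ^+ 2 + y1 s ^+ 2) / a <= a * eta.
    exists (s0 - 1); first by rewrite ltrBlDr ltrDl.
    move=> s ss; apply: le_trans (ler_norm _) _; apply: s0P.
    by rewrite (le_lt_trans ss)// ltrBlDr ltrDl.
  (* below s1 the inequality g' >= a (g - eta) makes h nondecreasing *)
  pose h s := (g s - eta) * expR (- a * s).
  have dh s : is_derive s (1 : R) h
      ((2 * a * g s + 2 * (x s * x1 s + y s * y1 s) - a * (g s - eta))
       * expR (- a * s)).
    have d1 := dg s; have d2 := is_derive_expR_scale (- a) s.
    have d3 : is_derive s (1 : R) (fun s => g s - eta)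
      (2 * a * g s + 2 * (x s * x1 s + y s * y1 s)).
      rewrite -[X in is_derive _ _ _ X]subr0.
      exact: (is_deriveB d1 (is_derive_cst eta s (1 : R))).
    have d4 := is_deriveM d3 d2; rewrite /h.
    apply: (is_derive_eq d4); rewrite /GRing.scale/=; ring.
  have hmono s : s <= s1 -> h s <= h s1.
    move=> ss1; apply: (@ger0_derive1_ndecrNy _ h s1) => //.
    - move=> u; rewrite in_itv/= => us1; rewrite derive1E.
      have [_ ->] := dh u; rewrite mulr_ge0 ?expR_ge0//.
      have := fs1 u (ltW us1); rewrite ler_pdivrMr// => fu.
      rewrite -(pmulr_rge0 _ a0) /g.
      have := sqr_ge0 (a * x u + x1 u); have := sqr_ge0 (a * y u + y1 u).
      nra.
    - apply: continuous_subspaceT => u.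
      by have [d _] := dh u; exact/differentiable_continuous/derivable1_diffP.
  have small : (fun s => `|h s1| * expR (a * s)) @ -oo --> 0.
    rewrite -[X in _ --> X](mulr0 `|h s1|); apply: cvgM; first exact: cvg_cst.
    apply/cvgNy_compNP; have := @cvgr_expR R => hE.
    have ay : (fun s => a * s) @ +oo --> +oo by apply: gt0_cvgMry => //; exact: cvg_id.
    apply: cvg_trans (cvg_comp _ _ ay hE); apply: near_eq_cvg.
    by apply: nearW => s /=; rewrite mulrN.
  move/cvgr0Pnorm_le : small => /(_ _ eta0) small.
  have ls1 : \forall s \near -oo, s <= s1 by apply: nbhs_ninfty_le; exact: num_real.
  apply: filterS2 small ls1 => s small ss1.
  rewrite ger0_norm; last by rewrite /g addr_ge0 ?sqr_ge0.
  have := hmono s ss1; rewrite {1}/h mulNr expRN ler_pdivrMr ?expR_gt0// => hs.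
  have le1 : h s1 * expR (a * s) <= eta.
    apply: le_trans (le_trans _ (ler_norm _)) small.
    by rewrite ler_wpM2r ?expR_ge0 ?ler_norm.
  by move: hs le1; rewrite /eta; lra.
have sub (z : R -> R) : (forall s, z s ^+ 2 <= g s) -> z @ -oo --> 0.
  move=> zg; apply/cvgr0Pnorm_le => eps eps0.
  have /cvgr0Pnorm_le/(_ _ (exprn_gt0 2 eps0)) := g0.
  apply: filterS => s gs.
  rewrite -(@ler_pXn2r _ 2)// ?nnegrE ?(ltW eps0)// real_normK ?num_real//.
  exact: le_trans (zg s) (le_trans (ler_norm _) gs).
by split; apply: sub => s; rewrite /g ?lerDl ?lerDr sqr_ge0.
Qed.

End PlanarSystem.

Section PlanarInvariants.
Variables (R : realType) (a b : R).

(** The rotation part [b] does not change the radius, so the real part of an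
    eigenvalue can be read off the squared radius alone. *)
Lemma planar_radius (x y : R -> R) (s : R) :
  (forall s, is_derive s (1 : R) x (a * x s - b * y s)) ->
  (forall s, is_derive s (1 : R) y (b * x s + a * y s)) ->
  x s ^+ 2 + y s ^+ 2 = expR (2 * a * s) * (x 0 ^+ 2 + y 0 ^+ 2).
Proof.
move=> dx dy.
pose h u := (x u * x u + y u * y u) * expR (- (2 * a) * u).
suff -> : x s ^+ 2 + y s ^+ 2 = expR (2 * a * s) * h s.
  have -> : h s = h 0.
    apply: is_derive_0_is_cst => u.
    have dE := is_derive_expR_scale (- (2 * a)) u.
    have hx := dx u; have hy := dy u.
    have hg : is_derive u (1 : R) (x * x + y * y)
      (2 * a * (x u * x u + y u * y u)).
      by apply: is_derive_eq; rewrite /GRing.scale/=; ring.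
    have d4 := is_deriveM hg dE; rewrite /h.
    apply: (is_derive_eq d4); rewrite /GRing.scale/= !fctE/=; ring.
  by rewrite /h mulr0 expR0 mulr1 !expr2.
rewrite /h mulrCA mulNr expRN mulfV ?mulr1 ?expr2//.
by rewrite expR_eq0.
Qed.

(** A Jordan block of size two on the imaginary axis: the driving pair
    [(x1, y1)] has constant radius and feeds [(x, y)] in phase, hence the linear
    growth that excludes multiple roots of the minimal polynomial. *)
Lemma planar_resonance (x y x1 y1 : R -> R) (s : R) :
  (forall s, is_derive s (1 : R) x (- b * y s + x1 s)) ->
  (forall s, is_derive s (1 : R) y (b * x s + y1 s)) ->
  (forall s, is_derive s (1 : R) x1 (- b * y1 s)) ->
  (forall s, is_derive s (1 : R) y1 (b * x1 s)) ->
  x s * x1 s + y s * y1 s =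
    x 0 * x1 0 + y 0 * y1 0 + s * (x1 0 ^+ 2 + y1 0 ^+ 2).
Proof.
move=> dx dy dx1 dy1.
have r0 u : x1 u ^+ 2 + y1 u ^+ 2 = x1 0 ^+ 2 + y1 0 ^+ 2.
  pose h u := x1 u * x1 u + y1 u * y1 u.
  suff : h u = h 0 by rewrite /h !expr2.
  apply: is_derive_0_is_cst => v; have hx := dx1 v; have hy := dy1 v.
  have hg : is_derive v (1 : R) (x1 * x1 + y1 * y1) 0.
    by apply: is_derive_eq; rewrite /GRing.scale/=; ring.
  exact: hg.
pose c := x1 0 ^+ 2 + y1 0 ^+ 2.
pose k u := x u * x1 u + y u * y1 u - c * u.
suff : k s = k 0 by rewrite /k mulr0 subr0 -/c [s * c]mulrC => <-; rewrite subrK.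
apply: is_derive_0_is_cst => u.
have hx := dx u; have hy := dy u; have hx1 := dx1 u; have hy1 := dy1 u.
have hg : is_derive u (1 : R) (x * x1 + y * y1) c.
  apply: is_derive_eq; rewrite /GRing.scale/= /c -(r0 u); ring.
have hc : is_derive u (1 : R) (fun u => c * u) c.
  have := is_deriveZ c (is_derive_id u (1 : R)).
  by rewrite /GRing.scale/= mulr1.
rewrite -[X in is_derive _ _ _ X](subrr c).
exact: (is_deriveB hg hc).
Qed.

End PlanarInvariants.

Section ComplexParts.
Variables (R : realType) (m n : nat).
Local Notation C := (R[i]).
Local Notation reM := (map_mx (@complex.Re R)).
Local Notation imM := (map_mx (@complex.Im R)).

Lemma Re_sum k (f : 'I_k -> C) :
  complex.Re (\sum_i f i) = \sum_i complex.Re (f i).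
Proof. by apply: (big_morph (@complex.Re R)) => // -[? ?] [? ?]. Qed.

Lemma Im_sum k (f : 'I_k -> C) :
  complex.Im (\sum_i f i) = \sum_i complex.Im (f i).
Proof. by apply: (big_morph (@complex.Im R)) => // -[? ?] [? ?]. Qed.

Lemma reM_mul (W : 'M[C]_(m, n)) (A : 'M[R]_n) :
  reM (W *m map_mx (real_complex R) A) = reM W *m A.
Proof.
apply/matrixP => i j; rewrite !mxE Re_sum; apply: eq_bigr => k _.
by rewrite !mxE; case: (W i k) => u v /=; rewrite mulr0 subr0.
Qed.

Lemma imM_mul (W : 'M[C]_(m, n)) (A : 'M[R]_n) :
  imM (W *m map_mx (real_complex R) A) = imM W *m A.
Proof.
apply/matrixP => i j; rewrite !mxE Im_sum; apply: eq_bigr => k _.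
by rewrite !mxE; case: (W i k) => u v /=; rewrite mulr0 add0r.
Qed.

Lemma reM_scale z (W : 'M[C]_(m, n)) :
  reM (z *: W) = complex.Re z *: reM W - complex.Im z *: imM W.
Proof. by apply/matrixP => i j; rewrite !mxE; case: z (W i j) => [? ?] []. Qed.

Lemma imM_scale z (W : 'M[C]_(m, n)) :
  imM (z *: W) = complex.Im z *: reM W + complex.Re z *: imM W.
Proof.
by apply/matrixP => i j; rewrite !mxE; case: z (W i j) => [? ?] [? ?] /=; rewrite addrC.
Qed.

Lemma reM_add (V W : 'M[C]_(m, n)) : reM (V + W) = reM V + reM W.
Proof. by apply/matrixP => i j; rewrite !mxE; case: (V i j) (W i j) => [? ?] []. Qed.

Lemma imM_add (V W : 'M[C]_(m, n)) : imM (V + W) = imM V + imM W.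
Proof. by apply/matrixP => i j; rewrite !mxE; case: (V i j) (W i j) => [? ?] []. Qed.

(** This is how the real exponential sees complex spectral data: [V = 0] for an
    eigenvector, [V] an eigenvector for a chain of length two, [V] arbitrary when
    a linear factor is split off an annihilating polynomial. *)
Lemma mexp_planar (A : 'M[R]_n) (z : C) (W V : 'M[C]_(m, n)) i j :
  W *m map_mx (real_complex R) A = z *: W + V ->
  let x s := (reM W *m mexp A s) i j in let y s := (imM W *m mexp A s) i j in
  let x1 s := (reM V *m mexp A s) i j in let y1 s := (imM V *m mexp A s) i j in
  (forall s, is_derive s (1 : R) x
     (complex.Re z * x s - complex.Im z * y s + x1 s)) /\
  (forall s, is_derive s (1 : R) y
     (complex.Im z * x s + complex.Re z * y s + y1 s)).
Proof.
move=> WA x y x1 y1.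
have d (B : 'M[R]_(m, n)) : mx_is_derive (fun s => B *m mexp A s)
    (fun s => B *m A *m mexp A s).
  have := mx_is_derive_mul (mx_is_derive_cst B) (mexp_is_derive A).
  by move=> h s k l; have := h s k l; rewrite mul0mx add0r mulmxA.
have entE (p q : R) (B B1 B2 : 'M[R]_(m, n)) :
  (p *: B + q *: B1 + B2) i j = p * B i j + q * B1 i j + B2 i j by rewrite !mxE.
split=> s.
  have := d (reM W) s i j; rewrite -reM_mul WA reM_add reM_scale -scaleNr.
  by rewrite !mulmxDl -!scalemxAl entE mulNr.
have := d (imM W) s i j; rewrite -imM_mul WA imM_add imM_scale.
by rewrite !mulmxDl -!scalemxAl entE.
Qed.

End ComplexParts.

Section Spectrum.
Variables (R : realType) (n : nat) (A : 'M[R]_n.+1).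
Local Notation C := (R[i]).
Local Notation cA := (map_mx (real_complex R) A).
Local Notation reM := (map_mx (@complex.Re R)).
Local Notation imM := (map_mx (@complex.Im R)).

Let decays m (W : 'M[C]_(m, n.+1)) : Prop := forall i j,
  (fun s => (reM W *m mexp A s) i j) @ -oo --> 0 /\
  (fun s => (imM W *m mexp A s) i j) @ -oo --> 0.

Let decays_factor m (W : 'M[C]_(m, n.+1)) z : 0 < complex.Re z ->
  decays (W *m (cA - z%:M)) -> decays W.
Proof.
move=> z0 dV i j; have [dVr dVi] := dV i j.
have WA : W *m cA = z *: W + W *m (cA - z%:M).
  by rewrite mulmxBr mul_mx_scalar addrC subrK.
have [dx dy] := mexp_planar i j WA.
exact: (planar_decay dx dy).
Qed.

(** By the Cayley-Hamilton theorem the characteristic polynomial, a product of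
    linear factors over the complex numbers, kills the matrix; stripping the
    factors one at a time propagates the decay from zero to the identity. *)
Lemma mexp_decay : Qmx A -> mexp A s @[s --> -oo] --> (0 : 'M[R]_n.+1).
Proof.
move=> [_ QA].
have [rs prs] := closed_field_poly_normal (char_poly cA).
rewrite (monicP (char_poly_monic cA)) scale1r in prs.
have rs0 z : z \in rs -> 0 < complex.Re z.
  move=> zrs; apply: QA; rewrite /ceigenvalue eigenvalue_root_char prs.
  by rewrite root_prod_XsubC.
have strip (s : seq C) : {subset s <= rs} -> forall W : 'M[C]_n.+1,
    decays (W *m \prod_(z <- s) (cA - z%:M)) -> decays W.
  elim: s => [|z s IH] sub W; first by rewrite big_nil mulmx1.
  rewrite big_cons -mulmxE mulmxA => /IH; rewrite -/(decays _) => h.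
  apply: (@decays_factor _ _ z); first by apply/rs0/sub; rewrite inE eqxx.
  by apply: h => u us; apply: sub; rewrite inE us orbT.
have d1 : decays (1%:M : 'M[C]_n.+1).
  apply: (strip rs) => //.
  have -> : \prod_(z <- rs) (cA - z%:M) = 0.
    rewrite -(Cayley_Hamilton cA) prs rmorph_prod/=; apply: eq_bigr => z _.
    by rewrite rmorphB/= horner_mx_X horner_mx_C.
  rewrite mulmx0 => i j.
  have -> : reM (0 : 'M[C]_n.+1) = 0 by apply/matrixP => k l; rewrite !mxE.
  have -> : imM (0 : 'M[C]_n.+1) = 0 by apply/matrixP => k l; rewrite !mxE.
  by split; apply: cvg_near_cst; apply: nearW => s; rewrite mul0mx mxE.
apply/mx_cvgP => i j; rewrite mxE; have [+ _] := d1 i j.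
have -> : reM (1%:M : 'M[C]_n.+1) = 1%:M.
  by apply/matrixP => k l; rewrite !mxE; case: (_ == _).
by under eq_fun do rewrite mul1mx.
Qed.

(** Here [u] and [v] are the real and imaginary parts of a left eigenvector, and
    [j] is a coordinate where it does not vanish. *)
Let eigen_growth z : ceigenvalue A z -> exists (u v : 'rV[R]_n.+1) (j : 'I_n.+1),
  0 < u 0 j ^+ 2 + v 0 j ^+ 2 /\
  forall s, (u *m mexp A s) 0 j ^+ 2 + (v *m mexp A s) 0 j ^+ 2 =
    expR (2 * complex.Re z * s) * (u 0 j ^+ 2 + v 0 j ^+ 2).
Proof.
move=> /eigenvalueP[w wA w0].
have [j wj] : exists j, w 0 j != 0 by apply/rV0Pn.
exists (reM w), (imM w), j; split.
  rewrite !mxE; case: (w 0 j) wj => a b /=; rewrite eq_complex/= negb_and => h.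
  rewrite lt_neqAle addr_ge0 ?sqr_ge0// andbT eq_sym paddr_eq0 ?sqr_ge0//.
  by rewrite !sqrf_eq0 negb_and.
move=> s.
have wA' : w *m cA = z *: w + 0 by rewrite addr0.
have [dx dy] := mexp_planar 0 j wA'.
have re0 : reM (0 : 'rV[C]_n.+1) = 0 by apply/matrixP => k l; rewrite !mxE.
have im0 : imM (0 : 'rV[C]_n.+1) = 0 by apply/matrixP => k l; rewrite !mxE.
have := @planar_radius _ (complex.Re z) (complex.Im z)
  (fun s => (reM w *m mexp A s) 0 j) (fun s => (imM w *m mexp A s) 0 j) s.
rewrite /= mexp0 !mulmx1; apply => u.
  by have := dx u; rewrite re0 mul0mx [(0 : 'rV_n.+1) 0 j]mxE addr0.
by have := dy u; rewrite im0 mul0mx [(0 : 'rV_n.+1) 0 j]mxE addr0.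
Qed.

Let entry_bound m (B : 'M[R]_(m, n.+1)) K s i j : `|mexp A s| <= K ->
  (B *m mexp A s) i j ^+ 2 <= (n.+1%:R * `|B| * K) ^+ 2.
Proof.
move=> AK; rewrite -real_normK ?num_real// lerXn2r ?nnegrE//.
  by rewrite !mulr_ge0// (le_trans _ AK).
rewrite (le_trans (mx_entry_le _ _ _))// (le_trans (mulmx_norm _ _))//.
by rewrite ler_wpM2l// mulr_ge0.
Qed.

Lemma bounded_mexp_Re_ge0 K s0 z : (forall s, s <= s0 -> `|mexp A s| <= K) ->
  ceigenvalue A z -> 0 <= complex.Re z.
Proof.
move=> AK /eigen_growth[u [v [j [g0 growth]]]].
rewrite leNgt; apply/negP => z0.
pose c := u 0 j ^+ 2 + v 0 j ^+ 2; rewrite -/c in g0.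
pose M := (n.+1%:R * `|u| * K) ^+ 2 + (n.+1%:R * `|v| * K) ^+ 2.
have bd s : s <= s0 -> (2 * complex.Re z * s) * c <= M.
  move=> /AK Ks; apply: (@le_trans _ _ (expR (2 * complex.Re z * s) * c)).
    rewrite ler_wpM2r ?(ltW g0)// (le_trans _ (expR_ge1Dx _))//.
    by rewrite lerDr.
  by rewrite -growth lerD// entry_bound.
have k0 : 2 * complex.Re z * c < 0 by rewrite nmulr_rlt0 ?pmulr_rlt0.
pose s1 := (M + 1) / (2 * complex.Re z * c).
have [s01|s01] := leP s1 s0.
  have := bd _ s01; rewrite mulrAC /s1 mulrCA mulfV ?lt_eqF// mulr1.
  by rewrite gerDl ler10.
have := bd _ (lexx s0); rewrite mulrAC => b0.
have : M + 1 <= (2 * complex.Re z * c) * s0.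
  by rewrite -ler_ndivlMl// mulrC ltW.
by move=> /le_trans/(_ b0); rewrite gerDl ler10.
Qed.

(** If [z] were a multiple root on the imaginary axis, with minimal polynomial
    [q * ('X - z) ^+ 2], the rows of [q] at [A] would start chains of length two
    and grow linearly by [planar_resonance]. *)
Lemma bounded_mexp_Mmx K s0 : (forall s, s <= s0 -> `|mexp A s| <= K) -> Mmx A.
Proof.
move=> AK z zA; split; first exact: bounded_mexp_Re_ge0 AK zA.
move=> z0; rewrite -mxminpoly_map.
have pn0 : mxminpoly cA != 0 by rewrite monic_neq0 ?mxminpoly_monic.
apply/eqP; rewrite eqn_leq andbC mup_geq// expr1 dvdp_XsubCl.
rewrite -eigenvalue_root_min; apply/andP; split; first exact: zA.
rewrite leqNgt; apply/negP; rewrite mup_geq// => /dvdpP[q pq].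
pose W := horner_mx cA q.
have hX : horner_mx cA ('X - z%:P) = cA - z%:M.
  by rewrite rmorphB/= horner_mx_X horner_mx_C.
have V0 : W *m (cA - z%:M) != 0.
  apply/negP => /eqP V0; have : mxminpoly cA %| q * ('X - z%:P).
    by apply: mxminpoly_min; rewrite rmorphM/= hX -mulmxE.
  have qn0 : q != 0 by apply: contra_neq pn0 => q0; rewrite pq q0 mul0r.
  move/dvdp_leq; rewrite mulf_neq0 ?polyXsubC_eq0// => /(_ isT).
  rewrite pq expr2 mulrA size_Mmonic ?monicXsubC ?mulf_neq0 ?polyXsubC_eq0//.
  by rewrite size_XsubC addn2 ltnn.
have VA : W *m (cA - z%:M) *m cA = z *: (W *m (cA - z%:M)) + 0.
  have : W *m (cA - z%:M) *m (cA - z%:M) = 0.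
    have := mx_root_minpoly cA; rewrite pq rmorphM/= rmorphXn/= hX.
    by rewrite expr2 -!mulmxE mulmxA.
  rewrite [_ *m (cA - z%:M) *m _]mulmxBr mul_mx_scalar => /eqP.
  by rewrite subr_eq0 addr0 => /eqP.
set V := W *m (cA - z%:M) in V0 VA.
have WA : W *m cA = z *: W + V.
  by rewrite /V mulmxBr mul_mx_scalar addrC subrK.
clearbody V.
have [i [j Vij]] : exists i j, V i j != 0.
  apply: contrapT => nV; move/eqP: V0; apply; apply/matrixP => i j.
  apply: contrapT => Vij; apply: nV; exists i, j; apply/eqP => V0; apply: Vij.
  by rewrite V0 mxE.
have [dx dy] := mexp_planar i j WA; have [dx1 dy1] := mexp_planar i j VA.
have re0 : reM (0 : 'M[C]_n.+1) = 0 by apply/matrixP => k l; rewrite !mxE.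
have im0 : imM (0 : 'M[C]_n.+1) = 0 by apply/matrixP => k l; rewrite !mxE.
pose x s := (reM W *m mexp A s) i j; pose y s := (imM W *m mexp A s) i j.
pose x1 s := (reM V *m mexp A s) i j; pose y1 s := (imM V *m mexp A s) i j.
pose c := x1 0 ^+ 2 + y1 0 ^+ 2.
have c0 : 0 < c.
  rewrite /c /x1 /y1 mexp0 !mulmx1 !mxE; case: (V i j) Vij => a b /=.
  rewrite eq_complex/= negb_and => h.
  rewrite lt_neqAle addr_ge0 ?sqr_ge0// andbT eq_sym paddr_eq0 ?sqr_ge0//.
  by rewrite !sqrf_eq0 negb_and.
have res s : x s * x1 s + y s * y1 s = x 0 * x1 0 + y 0 * y1 0 + s * c.
  apply: (@planar_resonance _ (complex.Im z) x y x1 y1 s) => u.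
  - by have := dx u; rewrite z0 mul0r add0r -mulNr.
  - by have := dy u; rewrite z0 mul0r addr0.
  - have := dx1 u; rewrite z0 mul0r add0r re0 mul0mx [(0 : 'M[R]_n.+1) i j]mxE.
    by rewrite addr0 -mulNr.
  - have := dy1 u; rewrite z0 mul0r addr0 im0 mul0mx [(0 : 'M[R]_n.+1) i j]mxE.
    by rewrite addr0.
pose N (B : 'M[R]_n.+1) : R := (n.+1%:R * `|B| * K) ^+ 2.
pose M := N (reM W) + N (imM W) + N (reM V) + N (imM V).
have amgm (e f : R) : - (e ^+ 2 + f ^+ 2) <= e * f.
  by have := sqr_ge0 (e + f); have := sqr_ge0 e; have := sqr_ge0 f; nra.
have bd s : s <= s0 -> - M <= x 0 * x1 0 + y 0 * y1 0 + s * c.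
  move=> /AK Ks; rewrite -res /M.
  have := entry_bound (reM W) i j Ks; have := entry_bound (imM W) i j Ks.
  have := entry_bound (reM V) i j Ks; have := entry_bound (imM V) i j Ks.
  rewrite -/(x s) -/(y s) -/(x1 s) -/(y1 s) -/(N _) -/(N _) -/(N _) -/(N _).
  move=> h1 h2 h3 h4; apply: le_trans (lerD (amgm (x s) (x1 s)) (amgm (y s) (y1 s))).
  rewrite -opprD lerN2.
  rewrite [leRHS](_ : _ = N (reM W) + N (reM V) + (N (imM W) + N (imM V))); last by ring.
  by rewrite !lerD.
pose s1 := - (M + (x 0 * x1 0 + y 0 * y1 0) + 1) / c.
have s1c : s1 * c = - (M + (x 0 * x1 0 + y 0 * y1 0) + 1).
  by rewrite /s1 mulfVK// gt_eqF.
have [s01|s01] := leP s1 s0.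
  by have := bd _ s01; rewrite s1c; lra.
have := bd _ (lexx s0); have : s0 * c < s1 * c by rewrite ltr_pM2r.
by rewrite s1c; lra.
Qed.

Lemma mexp_decay_Qmx : mexp A s @[s --> -oo] --> (0 : 'M[R]_n.+1) -> Qmx A.
Proof.
move=> A0.
have QA z : ceigenvalue A z -> 0 < complex.Re z.
  move=> zA; have [u [v [j [g0 growth]]]] := eigen_growth zA.
  rewrite ltNge; apply/negP => z0.
  have uA (w : 'rV[R]_n.+1) : (fun s => (w *m mexp A s) 0 j) @ -oo --> 0.
    have : (fun s => w *m mexp A s) @ -oo --> w *m (0 : 'M[R]_n.+1).
      by apply: mulmx_cvg => //; exact: cvg_cst.
    by move/mx_cvgP => /(_ 0 j); rewrite mulmx0 mxE.
  have : (fun s => (u *m mexp A s) 0 j ^+ 2 + (v *m mexp A s) 0 j ^+ 2) @ -oo --> 0.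
    have -> : 0 = 0 ^+ 2 + 0 ^+ 2 :> R by rewrite expr0n/= addr0.
    by apply: cvgD; apply: cvgM; exact: uA.
  move=> /cvgrPdist_lt/(_ _ g0) small.
  have s0 : \forall s \near -oo, s <= (0 : R).
    by apply: nbhs_ninfty_le; exact: num_real.
  have [s [ss sl]] := filter_ex (filterI s0 small).
  move: sl; rewrite /= sub0r normrN growth ger0_norm; last first.
    by rewrite mulr_ge0 ?expR_ge0// ltW.
  rewrite ltNge => /negP; apply; rewrite ler_peMl ?(ltW g0)//.
  rewrite -expR0 ler_expR -mulrA mulr_ge0// mulr_le0 //.
split => //; rewrite unitmxE unitfE; apply/negP => /det0P[v v0 vA].
have /QA : ceigenvalue A 0.
  apply/eigenvalueP; exists (map_mx (real_complex R) v).
    by rewrite -map_mxM vA map_mx0 scale0r.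
  by rewrite map_mx_eq0.
by rewrite ltxx.
Qed.

End Spectrum.

(** * Random matrices *)

Section RandomMatrix.
Context {R : realType} {disp : measure_display} {T : measurableType disp}.

Definition mx_measurable m n (X : T -> 'M[R]_(m, n)) : Prop :=
  measurable_fun [set: T] (X : T -> borel 'M[R]_(m, n)).

Lemma mx_measurableP m n (X : T -> 'M[R]_(m, n)) :
  (forall O, open O -> measurable (X @^-1` O)) <-> mx_measurable X.
Proof.
split=> [XO|mX O oO]; last first.
  by rewrite -[X in measurable X]setTI; apply: mX => //; exact: sub_sigma_algebra.
apply: (@measurability _ _ _ _ setT (X : T -> borel 'M[R]_(m, n)) open); first by [].
by move=> _ [B oB <-]; rewrite setTI; exact: XO.
Qed.

Lemma mx_measurable_comp m n p q (X : T -> 'M[R]_(m, n))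
    (f : 'M[R]_(m, n) -> 'M[R]_(p, q)) :
  mx_measurable X -> continuous f -> mx_measurable (f \o X).
Proof.
move=> /mx_measurableP mX cf; apply/mx_measurableP => O oO.
rewrite comp_preimage; apply: mX.
by apply: open_comp => // x _; exact: cf.
Qed.

(** Open sets of matrices are countable unions of rational boxes, so that
    measurability can be checked entry by entry. *)
Lemma mx_measurable_entries m n (X : T -> 'M[R]_(m, n)) :
  (forall i j (O : set R), open O -> measurable [set w | O (X w i j)]) ->
  mx_measurable X.
Proof.
move=> mX; apply/mx_measurableP => O oO.
pose box (qk : 'M[rat]_(m, n) * nat) := [set x : 'M[R]_(m, n) |
  forall i j, ball (ratr (qk.1 i j) : R) qk.2.+1%:R^-1 (x i j)].
have -> : X @^-1` O = \bigcup_qk [set w | box qk `<=` O /\ box qk (X w)].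
  apply/seteqP; split=> [w Ow|w [qk _ [bO bw]]]; last exact: bO.
  have [e/= e0 eO] : nbhs_ball (X w) O.
    by apply/nbhs_ballP; exact: open_nbhs_nbhs.
  have [k ke] : exists k : nat, k.+1%:R^-1 < e / 2.
    have e20 : 0 < e / 2 by rewrite divr_gt0.
    have /cvgr0Pnorm_lt/(_ _ e20)[k _ /(_ k (leqnn k))] := @cvg_harmonic R.
    by rewrite /= ger0_norm ?invr_ge0// => h; exists k.
  have k0 : 0 < k.+1%:R^-1 :> R by rewrite invr_gt0.
  have /choice[q qP] : forall ij : 'I_m * 'I_n, exists q : rat,
      `|ratr q - X w ij.1 ij.2| < k.+1%:R^-1 :> R.
    move=> ij; have [|q] := @rat_in_itvoo R (X w ij.1 ij.2) (X w ij.1 ij.2 + k.+1%:R^-1).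
      by rewrite ltrDl.
    rewrite in_itv/= => /andP[q1 q2]; exists q.
    by rewrite ger0_norm ?subr_ge0 ?(ltW q1)// ltrBlDl.
  exists (\matrix_(i, j) q (i, j), k) => //; split.
    move=> x bx; apply: eO; split => // i j.
    have := bx i j; have := qP (i, j); rewrite /= !mxE /ball/= => h1 h2.
    rewrite (splitr e) (le_lt_trans (ler_distD (ratr (q (i, j))) _ _))//.
    by rewrite ltrD// ?(lt_trans h2)// distrC (lt_trans h1).
  by move=> i j; rewrite /ball/= mxE; exact: (qP (i, j)).
apply: countable_bigcupT_measurable => // qk.
have [bO|bO] := pselect (box qk `<=` O); last first.
  rewrite (_ : [set w | _] = set0); first exact: measurable0.
  by apply/seteqP; split => // w [].
rewrite (_ : [set w | _] = \bigcap_(ij in [set: 'I_m * 'I_n])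
    [set w | ball (ratr (qk.1 ij.1 ij.2) : R) qk.2.+1%:R^-1 (X w ij.1 ij.2)]).
  apply: fin_bigcap_measurable; first exact: finite_finset.
  by move=> [i j] _ /=; apply: mX; exact: ball_open.
apply/seteqP; split => [w [_ bw] [i j] _ /=|w bw]; first exact: bw.
by split => // i j; exact: (bw (i, j)).
Qed.

Lemma mx_measurable_entry m n (X : T -> 'M[R]_(m, n)) i j (O : set R) :
  mx_measurable X -> open O -> measurable [set w | O (X w i j)].
Proof.
move=> /mx_measurableP mX oO; apply: (mX [set M | O (M i j)]).
by apply: open_comp => // x _; exact: coord_continuous.
Qed.

Lemma mx_measurable_pair m n p q r s (X : T -> 'M[R]_(m, n))
    (Y : T -> 'M[R]_(p, q)) (f : 'M[R]_(m, n) -> 'M[R]_(p, q) -> 'M[R]_(r, s)) :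
  mx_measurable X -> mx_measurable Y ->
  continuous (fun xy => f xy.1 xy.2) -> mx_measurable (fun w => f (X w) (Y w)).
Proof.
move=> mX mY cf.
pose Z w : 'rV[R]_(m * n + p * q) := row_mx (mxvec (X w)) (mxvec (Y w)).
have mZ : mx_measurable Z.
  apply: mx_measurable_entries => i j O oO.
  rewrite /Z; case: (split_ordP j) => k ->.
    rewrite (_ : [set w | _] = [set w | O (mxvec (X w) i k)]).
      case/mxvec_indexP: k => a b; rewrite (ord1 i).
      rewrite (_ : [set w | _] = [set w | O (X w a b)]).
        exact: mx_measurable_entry.
      by apply/seteqP; split => w /=; rewrite mxvecE.
    by apply/seteqP; split => w /=; rewrite row_mxEl.
  rewrite (_ : [set w | _] = [set w | O (mxvec (Y w) i k)]).
    case/mxvec_indexP: k => a b; rewrite (ord1 i).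
    rewrite (_ : [set w | _] = [set w | O (Y w a b)]).
      exact: mx_measurable_entry.
    by apply/seteqP; split => w /=; rewrite mxvecE.
  by apply/seteqP; split => w /=; rewrite row_mxEr.
pose g (z : 'rV[R]_(m * n + p * q)) := (vec_mx (lsubmx z) : 'M[R]_(m, n),
  vec_mx (rsubmx z) : 'M[R]_(p, q)).
rewrite (_ : (fun w => _) = (fun z => f (g z).1 (g z).2) \o Z); last first.
  by apply/funext => w /=; rewrite /g /Z row_mxKl row_mxKr !mxvecK.
apply: mx_measurable_comp => // z.
apply: (@continuous_comp _ _ _ g (fun xy => f xy.1 xy.2)); last exact: cf.
have c1 : (fun z : 'rV[R]_(m * n + p * q) => vec_mx (lsubmx z) : 'M[R]_(m, n)) @ z
    --> (vec_mx (lsubmx z) : 'M[R]_(m, n)).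
  apply/(@mx_cvgP _ _ _ _ (nbhs z)) => i j.
  rewrite (_ : (fun x => _) = fun x : 'rV[R]_(m * n + p * q) =>
    x 0 (lshift _ (mxvec_index i j))); last by apply/funext => x; rewrite !mxE.
  by rewrite !mxE; exact: coord_continuous.
have c2 : (fun z : 'rV[R]_(m * n + p * q) => vec_mx (rsubmx z) : 'M[R]_(p, q)) @ z
    --> (vec_mx (rsubmx z) : 'M[R]_(p, q)).
  apply/(@mx_cvgP _ _ _ _ (nbhs z)) => i j.
  rewrite (_ : (fun x => _) = fun x : 'rV[R]_(m * n + p * q) =>
    x 0 (rshift _ (mxvec_index i j))); last by apply/funext => x; rewrite !mxE.
  by rewrite !mxE; exact: coord_continuous.
exact: (cvg_pair c1 c2).
Qed.

End RandomMatrix.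

(** * Convergence in probability and equality in law *)

Section ConvergenceInProbability.
Context {R : realType} {disp : measure_display} {T : measurableType disp}.
Variable P : probability T R.

(** The exceptional event is kept measurable while [Q] itself need not be, which
    spares all measurability bookkeeping when such statements are combined. *)
Definition holds_off (delta : R) (Q : T -> Prop) : Prop :=
  exists N : set T, [/\ measurable N, (P N <= delta%:E)%E & forall w, ~ N w -> Q w].

Lemma holds_offW d1 d2 (Q1 Q2 : T -> Prop) : d1 <= d2 ->
  (forall w, Q1 w -> Q2 w) -> holds_off d1 Q1 -> holds_off d2 Q2.
Proof.
move=> d12 Q12 [N [mN PN NQ]]; exists N; split => //.
  by rewrite (le_trans PN)// lee_fin.
by move=> w /NQ /Q12.
Qed.

Lemma holds_offI d1 d2 (Q1 Q2 : T -> Prop) : holds_off d1 Q1 ->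
  holds_off d2 Q2 -> holds_off (d1 + d2) (fun w => Q1 w /\ Q2 w).
Proof.
move=> [N1 [m1 P1 NQ1]] [N2 [m2 P2 NQ2]]; exists (N1 `|` N2); split.
- exact: measurableU.
- by rewrite (le_trans (measureU2 _ m1 m2))// EFinD leeD.
- by move=> w /not_orP[/NQ1 ? /NQ2 ?].
Qed.

Lemma holds_off_all k d (Q : 'I_k -> T -> Prop) :
  (forall j, holds_off d (Q j)) -> holds_off (k%:R * d) (fun w => forall j, Q j w).
Proof.
elim: k Q => [|k IH] Q hQ.
  exists set0; split => //; first by rewrite measure0 mul0r.
  by move=> w _ [].
have h1 := IH (fun j => Q (lift ord0 j)) (fun j => hQ _).
apply: holds_offW (holds_offI (hQ ord0) h1); first by rewrite -nat1r mulrDl mul1r.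
by move=> w [Q0 Q1] j; case: (unliftP ord0 j) => [i|] ->.
Qed.

Lemma holds_off_le d (A B : set T) : measurable A -> measurable B ->
  holds_off d (fun w => A w -> B w) -> (P A <= P B + d%:E)%E.
Proof.
move=> mA mB [N [mN PN NAB]]; apply: (@le_trans _ _ (P (B `|` N))).
  rewrite le_measure ?inE//; first exact: measurableU.
  by move=> w Aw; have [Nw|/NAB/(_ Aw)] := pselect (N w); [right|left].
by rewrite (le_trans (measureU2 _ mB mN))// leeD2l.
Qed.

Lemma norm_gt_open m n (a : R) : open [set x : 'M[R]_(m, n) | a < `|x|].
Proof.
rewrite (_ : [set x | _] = (@Num.norm _ 'M[R]_(m, n)) @^-1` [set y | a < y]).
  by apply: open_comp; [move=> x _; exact: norm_continuous|exact: open_gt].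
by [].
Qed.

Lemma mx_measurable_norm_gt m n (X : T -> 'M[R]_(m, n)) (a : R) :
  mx_measurable X -> measurable [set w | a < `|X w|].
Proof.
by move=> /mx_measurableP mX; exact: (mX _ (@norm_gt_open m n a)).
Qed.

Lemma tight m n (X : T -> 'M[R]_(m, n)) (d : R) : mx_measurable X -> 0 < d ->
  exists2 K, 0 <= K & holds_off d (fun w => `|X w| <= K).
Proof.
move=> mX d0; pose N k := [set w | k%:R < `|X w|].
have mN k : measurable (N k) by exact: mx_measurable_norm_gt.
have N0 : \bigcap_k N k = set0.
  apply/seteqP; split => // w Nw.
  have := Nw (Num.truncn `|X w|).+1 I; rewrite /N/= ltNge => /negP; apply.
  by rewrite ltW// truncnS_gt.
have : (P \o N) @ \oo --> P (\bigcap_k N k).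
  apply: nonincreasing_cvg_mu => //.
  - by rewrite (le_lt_trans (probability_le1 _ _))// ltry.
  - by rewrite N0.
  - move=> k l kl; apply/subsetPset => w; rewrite /N/=; apply: le_lt_trans.
    by rewrite ler_nat.
rewrite N0 measure0 => /fine_cvgP[_ /cvgr0Pnorm_le/(_ _ d0)].
move=> [k _ /(_ k (leqnn k))] /= h; exists k%:R => //; exists (N k); split => //.
  rewrite -[P (N k)]fineK ?fin_num_measure// lee_fin.
  exact: le_trans (ler_norm _) h.
by move=> w; rewrite /N/= => /negP; rewrite -leNgt.
Qed.

Definition cvg_prob I (F : set_system I) m n (X : I -> T -> 'M[R]_(m, n))
    (X0 : T -> 'M[R]_(m, n)) : Prop :=
  forall e d : R, 0 < e -> 0 < d ->
    \forall i \near F, holds_off d (fun w => `|X i w - X0 w| <= e).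

Lemma cvg_prob_cst I (F : set_system I) m n (X : T -> 'M[R]_(m, n)) :
  Filter F -> cvg_prob F (fun=> X) X.
Proof.
move=> FF e d e0 d0; apply: nearW => _; exists set0; split => //.
  by rewrite measure0 lee_fin ltW.
by move=> w _; rewrite subrr normr0 ltW.
Qed.

Lemma cvg_prob_affine I (F : set_system I) m n k (A : I -> 'M[R]_(m, n))
    (A0 : 'M[R]_(m, n)) (X : I -> T -> 'M[R]_(n, k)) (X0 : T -> 'M[R]_(n, k))
    (c : I -> 'M[R]_(m, k)) (c0 : 'M[R]_(m, k)) :
  Filter F -> mx_measurable X0 -> A @ F --> A0 -> c @ F --> c0 ->
  cvg_prob F X X0 ->
  cvg_prob F (fun i w => A i *m X i w + c i) (fun w => A0 *m X0 w + c0).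
Proof.
move=> FF mX0 AF cF XF e d e0 d0.
have d20 : 0 < d / 2 by rewrite divr_gt0.
have e30 : 0 < e / 3 by rewrite divr_gt0.
have [K K0 XK] := tight mX0 d20.
pose a := n%:R * (`|A0| + 1) + 1.
have a0 : 0 < a by rewrite /a ltr_wpDl// mulr_ge0// addr_ge0.
pose b := n%:R * K + 1; have b0 : 0 < b by rewrite /b ltr_wpDl// mulr_ge0.
have A1 : \forall i \near F, `|A0 - A i| <= 1 by move/cvgrPdist_le : AF; apply.
have A2 : \forall i \near F, `|A0 - A i| <= e / 3 / b.
  by move/cvgrPdist_le : AF; apply; rewrite divr_gt0.
have c1 : \forall i \near F, `|c0 - c i| <= e / 3 by move/cvgrPdist_le : cF; apply.
have X1 := XF (e / 3 / a) (d / 2) (divr_gt0 e30 a0) d20.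
apply: filterS3 (filterI A1 A2) c1 X1 => i [Ai1 Ai2] ci Xi.
apply: holds_offW (holds_offI Xi XK); first by rewrite -splitr.
move=> w [XiX0 X0K].
have -> : A i *m X i w + c i - (A0 *m X0 w + c0) =
    A i *m (X i w - X0 w) + (A i - A0) *m X0 w + (c i - c0).
  rewrite mulmxBr mulmxBl opprD addrACA; congr (_ + _).
  by rewrite addrA subrK.
rewrite (le_trans (ler_normD _ _))// (_ : e = e / 3 + e / 3 + e / 3); last by field.
rewrite lerD//; last by rewrite distrC.
rewrite (le_trans (ler_normD _ _))// lerD//; rewrite (le_trans (mulmx_norm _ _))//.
  apply: (@le_trans _ _ (a * (e / 3 / a))); last by rewrite mulrC divfK ?gt_eqF.
  rewrite ler_pM ?mulr_ge0// (@le_trans _ _ (n%:R * (`|A0| + 1)))//.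
    rewrite ler_wpM2l//; have : `|A i| <= `|A0| + `|A0 - A i|.
      by rewrite distrC -[X in `|X| <= _](subrK A0) addrC (le_trans (ler_normD _ _)).
    by move/le_trans; apply; rewrite lerD2l.
  by rewrite lerDl.
apply: (@le_trans _ _ ((e / 3 / b) * b)); last by rewrite divfK ?gt_eqF.
rewrite -mulrA mulrCA ler_pM ?mulr_ge0//; first by rewrite distrC.
by rewrite (@le_trans _ _ (n%:R * K))// ?ler_wpM2l// lerDl.
Qed.

Lemma cvg_prob_columns I (F : set_system I) n k (X : I -> 'I_k -> T -> 'cV[R]_n) X0 :
  Filter F -> (forall j, cvg_prob F (X ^~ j) (X0 j)) ->
  cvg_prob F (fun i w => \matrix_(a, j) X i j w a 0)
    (fun w => (\matrix_(a, j) X0 j w a 0) : 'M[R]_(n, k)).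
Proof.
move=> FF XF e d e0 d0; pose d' := d / k.+1%:R.
have d'0 : 0 < d' by rewrite divr_gt0.
have : \forall i \near F, forall j, holds_off d' (fun w => `|X i j w - X0 j w| <= e).
  by apply: filter_forall => j; exact: XF.
apply: filterS => i /holds_off_all; apply: holds_offW.
  rewrite /d' mulrCA ler_piMr ?(ltW d0)// ler_pdivrMr// mul1r ler_nat.
  exact: leqnSn.
move=> w h; apply: mx_norm_le; first exact: ltW.
move=> a j; rewrite !mxE; apply: le_trans (h j).
by have := mx_entry_le (X i j w - X0 j w) a 0; rewrite !mxE.
Qed.

Definition eq_law m n (Y Z : T -> 'M[R]_(m, n)) : Prop :=
  forall B : set (borel 'M[R]_(m, n)), measurable B -> P (Y @^-1` B) = P (Z @^-1` B).

Lemma eq_law_sym m n (Y Z : T -> 'M[R]_(m, n)) : eq_law Y Z -> eq_law Z Y.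
Proof. by move=> YZ B mB; rewrite YZ. Qed.

Lemma eq_law_trans m n (X Y Z : T -> 'M[R]_(m, n)) :
  eq_law X Y -> eq_law Y Z -> eq_law X Z.
Proof. by move=> XY YZ B mB; rewrite XY// YZ. Qed.

Lemma eq_law_comp m n p q (Y Z : T -> 'M[R]_(m, n))
    (f : 'M[R]_(m, n) -> 'M[R]_(p, q)) :
  continuous f -> eq_law Y Z -> eq_law (f \o Y) (f \o Z).
Proof.
move=> cf YZ B mB; apply: (YZ (f @^-1` B)).
have mf : measurable_fun [set: borel 'M[R]_(m, n)]
    (f : borel 'M[R]_(m, n) -> borel 'M[R]_(p, q)).
  apply: (@measurability _ _ _ _ setT
    (f : borel 'M[R]_(m, n) -> borel 'M[R]_(p, q)) open).
    by [].
  move=> _ [C oC <-]; rewrite setTI; apply: sub_sigma_algebra.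
  by apply: open_comp => // x _; exact: cf.
by rewrite -[X in measurable X]setTI; exact: mf.
Qed.

(** Complements reduce open sets to closed ones, and open sets form a pi-system
    that generates the Borel sets. *)
Lemma eq_law_closed m n (Y Z : T -> 'M[R]_(m, n)) :
  mx_measurable Y -> mx_measurable Z ->
  (forall C, closed C -> P (Y @^-1` C) = P (Z @^-1` C)) -> eq_law Y Z.
Proof.
move=> mY mZ YZ.
have pre (X : T -> 'M[R]_(m, n)) (B : set (borel 'M[R]_(m, n))) :
    mx_measurable X -> measurable B -> measurable (X @^-1` B).
  by move=> mX mB; rewrite -[X in measurable X]setTI; exact: mX.
have compl (B : set (borel 'M[R]_(m, n))) : measurable B ->
    P (Y @^-1` B) = P (Z @^-1` B) -> P (Y @^-1` ~` B) = P (Z @^-1` ~` B).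
  by move=> mB YZB; rewrite -!preimage_setC !probability_setC ?YZB//; exact: pre.
apply: (@dynkin_induction _ (borel 'M[R]_(m, n)) open
  (fun B => P (Y @^-1` B) = P (Z @^-1` B))) => //.
- exact: openI.
- move=> G oG; rewrite -[G]setCK; apply: compl.
    by apply: measurableC; exact: sub_sigma_algebra.
  by apply: YZ; exact: open_closedC.
- move=> B mB tB YZB; rewrite !preimage_bigcup.
  rewrite !measure_bigcup//.
  + by apply: eq_eseriesr => k _; exact: YZB.
  + by move=> k _; exact: pre.
  + by move=> k l _ _ [w [Bk Bl]]; apply: tB => //; eexists; split; [exact: Bk|exact: Bl].
  + by move=> k _; exact: pre.
  + by move=> k l _ _ [w [Bk Bl]]; apply: tB => //; eexists; split; [exact: Bk|exact: Bl].
Qed.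

Definition thickening m n (C : set 'M[R]_(m, n)) (e : R) : set 'M[R]_(m, n) :=
  \bigcup_(y in C) ball y e.

Lemma open_thickening m n (C : set 'M[R]_(m, n)) (e : R) : open (thickening C e).
Proof. by apply: bigcup_open => y _; exact: ball_open. Qed.

(** Portmanteau by hand: if a limit [Y0] lies in a closed set, the nearby [Y i],
    hence the equally distributed [Z i], hence [Z0], lie in thickenings. *)
Lemma eq_law_lim I (F : set_system I) m n (Y Z : I -> T -> 'M[R]_(m, n)) Y0 Z0 :
  ProperFilter F -> mx_measurable Y0 -> mx_measurable Z0 ->
  (forall i, mx_measurable (Y i)) -> (forall i, mx_measurable (Z i)) ->
  cvg_prob F Y Y0 -> cvg_prob F Z Z0 ->
  (forall i, eq_law (Y i) (Z i)) -> eq_law Y0 Z0.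
Proof.
move=> FF mY0 mZ0 mY mZ YF ZF YZ.
have pre (X : T -> 'M[R]_(m, n)) (B : set (borel 'M[R]_(m, n))) :
    mx_measurable X -> measurable B -> measurable (X @^-1` B).
  by move=> mX mB; rewrite -[X in measurable X]setTI; exact: mX.
have mthick (C : set 'M[R]_(m, n)) e :
    @measurable _ (borel 'M[R]_(m, n)) (thickening C e).
  by apply: sub_sigma_algebra; exact: open_thickening.
suff le_closed (V W : I -> T -> 'M[R]_(m, n)) V0 W0 C : closed C ->
    mx_measurable V0 -> mx_measurable W0 ->
    (forall i, mx_measurable (V i)) -> (forall i, mx_measurable (W i)) ->
    cvg_prob F V V0 -> cvg_prob F W W0 -> (forall i, eq_law (V i) (W i)) ->
    (P (V0 @^-1` C) <= P (W0 @^-1` C))%E.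
  apply: eq_law_closed => // C cC; apply/eqP; rewrite eq_le; apply/andP; split.
    exact: (le_closed Y Z).
  by apply: (le_closed Z Y) => // i; exact: eq_law_sym.
move=> cC mV0 mW0 mV mW VF WF VW.
have mC : @measurable _ (borel 'M[R]_(m, n)) C.
  by rewrite -[C]setCK; apply: measurableC; apply: sub_sigma_algebra; exact: closed_openC.
have step (e : R) : 0 < e ->
    (P (V0 @^-1` C) <= P (W0 @^-1` thickening C e) + (e + e)%:E)%E.
  move=> e0; have e40 : 0 < e / 4 by rewrite divr_gt0.
  have [i [Vi Wi]] := filter_ex (filterI (VF _ _ e40 e0) (WF _ _ e40 e0)).
  have h1 : (P (V0 @^-1` C) <= P (V i @^-1` thickening C (e / 2)) + e%:E)%E.
    apply: holds_off_le; [exact: pre|exact: pre|].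
    apply: holds_offW Vi => // w h Cw; exists (V0 w) => //.
    rewrite -ball_normE /ball_/= distrC (le_lt_trans h)// ltr_pM2l//.
    by rewrite ltf_pV2 ?posrE// ltr_nat.
  have h2 : (P (W i @^-1` thickening C (e / 2)) <= P (W0 @^-1` thickening C e) + e%:E)%E.
    apply: holds_off_le; [exact: pre|exact: pre|].
    apply: holds_offW Wi => // w h [y Cy]; rewrite -ball_normE /ball_/= => yW.
    exists y => //; rewrite -ball_normE /ball_/=.
    rewrite -(subrK (W i w) y) -addrA (le_lt_trans (ler_normD _ _))// (splitr e).
    by rewrite ltrD// (le_lt_trans h)// ltr_pM2l// ltf_pV2 ?posrE// ltr_nat.
  by rewrite (le_trans h1)// EFinD addeA leeD2r// VW//.
pose N k := W0 @^-1` thickening C k.+1%:R^-1.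
have NC : \bigcap_k N k = W0 @^-1` C.
  apply/seteqP; split => w; last first.
    move=> Cw k _; exists (W0 w) => //; apply: ballxx.
    by rewrite invr_gt0.
  move=> Nw; apply: cC => B /nbhs_ballP[e/= e0 eB].
  have /cvgr0Pnorm_lt/(_ _ e0)[k _ /(_ k (leqnn k))] := @cvg_harmonic R.
  rewrite /= ger0_norm ?invr_ge0// => ke.
  have [y Cy] := Nw k Logic.I; rewrite -ball_normE /ball_/= => yW.
  by exists y; split => //; apply: eB; rewrite -ball_normE /ball_/= distrC (lt_trans yW).
have mN k : measurable (N k) by exact: pre.
have PN : (P \o N) @ \oo --> P (W0 @^-1` C).
  rewrite -NC; apply: nonincreasing_cvg_mu => //.
  - by rewrite (le_lt_trans (probability_le1 _ _))// ltry.
  - by rewrite NC; exact: pre.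
  - move=> k l kl; apply/subsetPset => w [y Cy yW]; exists y => //.
    by apply: le_ball yW; rewrite lef_pV2 ?posrE// ler_nat.
have h0 : (fun k => (k.+1%:R^-1 + k.+1%:R^-1 : R)%:E) @ \oo --> (0%:E : \bar R).
  apply: cvg_EFin; first exact: nearW.
  rewrite -[X in _ --> X]addr0; apply: cvgD; exact: cvg_harmonic.
have lim : (fun k => P (N k) + (k.+1%:R^-1 + k.+1%:R^-1 : R)%:E)%E @ \oo -->
    P (W0 @^-1` C).
  rewrite -[X in _ --> X]adde0; apply: cvgeD => //.
  by rewrite fin_num_adde_defl.
apply: (cvge_to_ge lim); apply: nearW => k; apply: step.
by rewrite invr_gt0.
Qed.

End ConvergenceInProbability.

(** * Convergence of types *)

Lemma affine_continuous (R : realType) m n k (A : 'M[R]_(m, n)) (c : 'M[R]_(m, k)) :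
  continuous (fun x : 'M[R]_(n, k) => A *m x + c).
Proof.
move=> x; have Ax : (fun y : 'M[R]_(n, k) => A *m y) @ x --> A *m x.
  exact: (@mulmx_cvg R _ _ _ _ (nbhs x) (fun=> A) id A x _ (cvg_cst A) cvg_id).
exact: (cvgD Ax (cvg_cst c)).
Qed.

Section ConvergenceOfTypes.
Context {R : realType} {disp : measure_display} {T : measurableType disp}.
Variable P : probability T R.

Lemma mx_measurable_affine m n k (A : 'M[R]_(m, n)) (X : T -> 'M[R]_(n, k))
    (c : 'M[R]_(m, k)) : mx_measurable X -> mx_measurable (fun w => A *m X w + c).
Proof.
by move=> mX; exact: (mx_measurable_comp mX (@affine_continuous _ _ _ _ A c)).
Qed.

Lemma eq_law_affine m n k (A : 'M[R]_(m, n)) (c : 'M[R]_(m, k))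
    (Y Z : T -> 'M[R]_(n, k)) : eq_law P Y Z ->
  eq_law P (fun w => A *m Y w + c) (fun w => A *m Z w + c).
Proof.
by move=> YZ; exact: (eq_law_comp (@affine_continuous _ _ _ _ A c) YZ).
Qed.

(** Both sequences keep most of their mass in a common ball, so a large shift
    would move the mass of one of them away from where the other one sits. *)
Lemma shift_bounded J (F : set_system J) m n (V W : J -> T -> 'M[R]_(m, n))
    V0 W0 (c : J -> 'M[R]_(m, n)) : ProperFilter F ->
  mx_measurable V0 -> mx_measurable W0 ->
  (forall i, mx_measurable (V i)) -> (forall i, mx_measurable (W i)) ->
  cvg_prob P F V V0 -> cvg_prob P F W W0 ->
  (forall i, eq_law P (V i) (fun w => W i w + c i)) ->
  exists K, \forall i \near F, `|c i| <= K.
Proof.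
move=> FF mV0 mW0 mV mW VF WF VW.
(* four exceptional events of probability 1/5 leave a common outcome *)
have d0 : 0 < 5^-1 :> R by rewrite invr_gt0.
have [K1 K10 V0K] := tight P mV0 d0; have [K2 K20 W0K] := tight P mW0 d0.
exists (K1 + K2 + 2); have := VF 1 5^-1 ltr01 d0; have := WF 1 5^-1 ltr01 d0.
apply: filterS2 => i Wi Vi; rewrite leNgt; apply/negP => ci.
have mVi := mx_measurable_norm_gt (K1 + 1) (mV i).
have tri (x y : 'M[R]_(m, n)) : `|x| <= `|x - y| + `|y|.
  by rewrite -[X in `|X| <= _](subrK y) ler_normD.
have PV : (P [set w | (K1 + 1 < `|V i w|)%R] <= (2 / 5 : R)%:E)%E.
  rewrite -[leRHS]add0e -(measure0 P).
  apply: holds_off_le => //.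
  apply: holds_offW (holds_offI Vi V0K); first by lra.
  move=> w [h1 h2] /=; have := tri (V i w) (V0 w) => h3 h4.
  suff : K1 + 1 < K1 + 1 by rewrite ltxx.
  by lra.
have mWi : measurable [set w | (K1 + 1 < `|W i w + c i|)%R].
  apply: (mx_measurable_norm_gt (K1 + 1) (X := fun w => W i w + c i)).
  have := mx_measurable_affine 1%:M (c i) (mW i).
  by under eq_fun do rewrite mul1mx.
have PW : (1 <= P [set w | (K1 + 1 < `|W i w + c i|)%R] + (2 / 5 : R)%:E)%E.
  rewrite -(probability_setT P).
  apply: holds_off_le => //.
  apply: holds_offW (holds_offI Wi W0K); first by lra.
  move=> w [h1 h2] _ /=; have := tri (W i w) (W0 w).
  have : `|c i| <= `|W i w + c i| + `|W i w|.
    by rewrite -[X in `|X| <= _](addKr (W i w)) addrC (le_trans (ler_normD _ _))// normrN.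
  by lra.
have PE : P [set w | (K1 + 1 < `|W i w + c i|)%R] = P [set w | (K1 + 1 < `|V i w|)%R].
  apply/esym; apply: (VW i [set x | (K1 + 1 < `|x|)%R]).
  by apply: sub_sigma_algebra; exact: norm_gt_open.
have : ((1 : R)%:E <= (2 / 5 + 2 / 5 : R)%:E)%E.
  rewrite EFinD (le_trans PW)// PE.
  exact: leeD2r.
rewrite lee_fin; lra.
Qed.

(** Bounded shifts converge along the ultrafilter, and the equality in law passes
    to the limit. *)
Lemma shift_cvg J (U : set_system J) m n (V W : J -> T -> 'M[R]_(m, n))
    V0 W0 (c : J -> 'M[R]_(m, n)) : UltraFilter U ->
  mx_measurable V0 -> mx_measurable W0 ->
  (forall i, mx_measurable (V i)) -> (forall i, mx_measurable (W i)) ->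
  cvg_prob P U V V0 -> cvg_prob P U W W0 ->
  (forall i, eq_law P (V i) (fun w => W i w + c i)) ->
  exists2 c0 : 'M[R]_(m, n), c @ U --> c0 & eq_law P V0 (fun w => W0 w + c0).
Proof.
move=> UU mV0 mW0 mV mW VU WU VW.
have [K cK] := shift_bounded _ mV0 mW0 mV mW VU WU VW.
have [c0 cc0] := ultra_mx_cvg UU cK; exists c0 => //.
have mWc (X : T -> 'M[R]_(m, n)) d : mx_measurable X -> mx_measurable (fun w => X w + d).
  by move=> /(mx_measurable_affine 1%:M d); under eq_fun do rewrite mul1mx.
apply: (eq_law_lim (F := U) (Y := V) (Z := fun i w => W i w + c i)) => //.
- exact: mWc.
- by move=> i; exact: mWc.
have := cvg_prob_affine (A := fun=> 1%:M) (A0 := 1%:M) _ mW0 (cvg_cst _) cc0 WU.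
under [X in cvg_prob _ _ X]eq_fun do under eq_fun do rewrite mul1mx.
by under [X in cvg_prob _ _ _ X]eq_fun do rewrite mul1mx; apply.
Qed.

(** A law invariant under a translation is invariant under its multiples, which
    tightness allows only for the null translation. *)
Lemma eq_law_shift_inj m n (W : T -> 'M[R]_(m, n)) c1 c2 : mx_measurable W ->
  eq_law P (fun w => W w + c1) (fun w => W w + c2) -> c1 = c2.
Proof.
move=> mW W12; pose e := c2 - c1.
have shift (X Y : T -> 'M[R]_(m, n)) d : eq_law P X Y ->
    eq_law P (fun w => X w + d) (fun w => Y w + d).
  move=> /(eq_law_affine 1%:M d).
  under [X in eq_law _ X _]eq_fun do rewrite mul1mx.
  by under [X in eq_law _ _ X]eq_fun do rewrite mul1mx.
have We : eq_law P W (fun w => W w + e).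
  have := shift _ _ (- c1) W12.
  under [X in eq_law _ X _]eq_fun do rewrite addrK.
  by under [X in eq_law _ _ X]eq_fun do rewrite -addrA.
have Wek k : eq_law P W (fun w => W w + e *+ k).
  elim: k => [|k IH]; first by under [X in eq_law _ _ X]eq_fun do rewrite mulr0n addr0.
  apply: eq_law_trans We _; have := shift _ _ e IH.
  by under [X in eq_law _ _ X]eq_fun do rewrite -addrA -mulrSr.
have [K [k0 _ eK]] := shift_bounded (F := \oo) _ mW mW (fun=> mW) (fun=> mW)
  (cvg_prob_cst P W _) (cvg_prob_cst P W _) Wek.
apply/eqP; rewrite eq_sym -subr_eq0 -/e -normr_eq0; apply: contrapT => /negP e0.
have e1 : 0 < `|e| by rewrite lt_def e0 normr_ge0.
pose k := (k0 + (Num.truncn (K / `|e|)).+1)%N.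
have := eK k (leq_addr _ _); rewrite /= normrMn -mulr_natl leNgt => /negP; apply.
rewrite -ltr_pdivrMr// (lt_le_trans (truncnS_gt _))// ler_nat.
exact: leq_addl.
Qed.

(** A nonzero row of [A] would confine the support of [Z] to a hyperplane. *)
Lemma full_not_degenerate m n (Z : T -> 'cV[R]_n) (A : 'M[R]_(m, n)) a :
  full (law P Z) -> eq_law P (fun w => A *m Z w) (fun=> a) -> A = 0.
Proof.
move=> fZ AZ; apply/row_matrixP => i; rewrite row0.
apply: contrapT => /eqP Ai0; apply: fZ; exists (row i A), (a i 0); split => // x sx.
apply: contrapT => /= xa.
pose G := [set y : 'cV[R]_n | (A *m y) i 0 != a i 0].
have oG : open G.
  apply: (@open_comp _ _ (fun y : 'cV[R]_n => (A *m y) i 0) [set r | r != a i 0]).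
    move=> y _; have := @affine_continuous _ _ _ _ A (0 : 'cV[R]_m) y.
    move=> /(@mx_cvgP _ _ _ _ (nbhs y))/(_ i 0).
    under eq_fun do rewrite addr0; rewrite addr0; exact.
  exact: open_neq.
have Gx : G x by apply/eqP; move: xa; rewrite -row_mul mxE.
have := sx G oG Gx; rewrite /law /pushforward.
have -> : Z @^-1` G = (fun w => A *m Z w) @^-1` [set y | y i 0 != a i 0] by [].
rewrite AZ; last first.
  apply: sub_sigma_algebra.
  apply: (@open_comp _ _ (fun y : 'cV[R]_m => y i 0) [set r | r != a i 0]).
    by move=> y _; exact: coord_continuous.
  exact: open_neq.
rewrite (_ : _ @^-1` _ = set0) ?measure0 ?ltxx//.
by apply/seteqP; split => // w /=; rewrite eqxx.
Qed.

(** Convergence of types: after dividing by the norm of [A i] an unbounded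
    family of scalings would make the image of the full law degenerate. *)
Lemma convergence_of_types J (U : set_system J) n (V : J -> T -> 'cV[R]_n) V0
    (Z : T -> 'cV[R]_n) (A : J -> 'M[R]_n) (c : J -> 'cV[R]_n) : UltraFilter U ->
  mx_measurable V0 -> mx_measurable Z -> (forall i, mx_measurable (V i)) ->
  full (law P Z) -> cvg_prob P U V V0 ->
  (forall i, eq_law P (V i) (fun w => A i *m Z w + c i)) ->
  exists A0 c0, [/\ A @ U --> (A0 : 'M[R]_n), c @ U --> (c0 : 'cV[R]_n) &
    eq_law P V0 (fun w => A0 *m Z w + c0)].
Proof.
move=> UU mV0 mZ mV fZ VU VAZ.
have AZ (B : J -> 'M[R]_n) (B0 : 'M[R]_n) : B @ U --> B0 ->
    cvg_prob P U (fun i w => B i *m Z w) (fun w => B0 *m Z w).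
  move=> BB0; have h : cvg_prob P U (fun i w => B i *m Z w + (0 : 'cV[R]_n))
      (fun w => B0 *m Z w + 0).
    apply: cvg_prob_affine => //; first exact: cvg_cst.
    exact: cvg_prob_cst.
  move=> e d e0 d0; apply: filterS (h e d e0 d0) => i; apply: holds_offW => //.
  by move=> w; rewrite !addr0.
have mAZ (B : 'M[R]_n) : mx_measurable (fun w => B *m Z w).
  have := mx_measurable_affine B 0 mZ.
  by under eq_fun do rewrite addr0.
have [[K AK]|Ainf] := ultra_unbounded (fun i => `|A i|) UU.
  have [A0 AA0] := ultra_mx_cvg UU AK.
  have [c0 cc0 law0] := shift_cvg UU mV0 (mAZ A0) mV (fun i => mAZ (A i)) VU
    (AZ _ _ AA0) VAZ.
  by exists A0, c0.
exfalso.
pose H i := `|A i|^-1 *: A i.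
have A0 : \forall i \near U, 0 < `|A i| by exact: Ainf.
have nH : \forall i \near U, `|H i| = 1.
  apply: filterS A0 => i Ai; rewrite normrZ normfV normr_id mulVf//.
  by rewrite gt_eqF.
have [H0 HH0] : exists H0 : 'M[R]_n, H @ U --> H0.
  by apply: (ultra_mx_cvg (K := 1)); apply: filterS nH => i ->.
have e0 : (fun i => `|A i|^-1) @ U --> (0 : R).
  apply/cvgr0Pnorm_le => e e0; apply: filterS2 A0 (Ainf e^-1) => i Ai eA.
  rewrite ger0_norm ?invr_ge0//; move: eA; rewrite -ltf_pV2 ?posrE ?invr_gt0//.
  by rewrite invrK; exact: ltW.
have V'U : cvg_prob P U (fun i w => `|A i|^-1%:M *m V i w + 0)
    (fun w => (0%:M : 'M[R]_n) *m V0 w + 0).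
  apply: cvg_prob_affine => //; last exact: cvg_cst.
  apply/mx_cvgP => i j; rewrite mxE; under eq_fun do rewrite mxE.
  by case: (i == j); rewrite ?mulr1n ?mulr0n//; exact: cvg_cst.
have V'E i : eq_law P (fun w => `|A i|^-1%:M *m V i w + 0)
    (fun w => H i *m Z w + `|A i|^-1 *: c i).
  have := eq_law_affine (`|A i|^-1%:M) 0 (VAZ i).
  under [X in eq_law _ _ X]eq_fun do
    rewrite addr0 mul_scalar_mx scalerDr scalemxAl.
  by [].
have [g0 _ lawH] := shift_cvg UU (mx_measurable_affine _ _ mV0) (mAZ H0)
  (fun i => mx_measurable_affine _ _ (mV i)) (fun i => mAZ (H i)) V'U (AZ _ _ HH0) V'E.
have H00 : H0 = 0.
  apply: (full_not_degenerate (a := - g0) fZ).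
  have := eq_law_affine 1%:M (- g0) (eq_law_sym lawH).
  under [X in eq_law _ X _]eq_fun do rewrite mul1mx addrK.
  by under [X in eq_law _ _ X]eq_fun do rewrite mul1mx addr0 mul_scalar_mx scale0r add0r.
have : (fun i => `|H i|) @ U --> (0 : R) by apply/norm_cvg0P; rewrite -H00.
move=> /cvgrPdist_lt/(_ _ ltr01) small.
have [i [/= Hi1]] := filter_ex (filterI nH small).
by rewrite Hi1 sub0r normrN normr1 ltxx.
Qed.

End ConvergenceOfTypes.

(** * The group of scalings of a self-similar field *)

Section FiniteDimensionalLaws.
Context {R : realType} {d n : nat} {disp : measure_display}.
Context {T : measurableType disp}.
Variable P : probability T R.
Implicit Types X Y : 'cV[R]_d -> T -> 'cV[R]_n.

Lemma eq_fdd_marginal X Y t : eq_fdd P X Y -> eq_law P (X t) (Y t).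
Proof.
move=> XY; have J (Z : 'cV[R]_d -> T -> 'cV[R]_n) :
    joint Z (fun _ : 'I_1 => t) = Z t.
  by apply/funext => w; apply/colP => i; rewrite mxE.
by move=> B mB; have := XY 1%N (fun=> t) B mB; rewrite !J.
Qed.

Lemma eq_fdd_reindex X Y (f : 'cV[R]_d -> 'cV[R]_d) :
  eq_fdd P X Y -> eq_fdd P (X \o f) (Y \o f).
Proof. by move=> XY k t; exact: (XY k (f \o t)). Qed.

Lemma joint_affine X (A : 'M[R]_n) (a : 'cV[R]_d -> 'cV[R]_n) k (t : 'I_k -> 'cV[R]_d) :
  joint (fun t w => A *m X t w + a t) t =
  fun w => A *m joint X t w + \matrix_(i, j) a (t j) i 0.
Proof.
apply/funext => w; apply/matrixP => i j; rewrite !mxE; congr (_ + _).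
by apply: eq_bigr => l _; rewrite mxE.
Qed.

Lemma eq_fdd_affine X Y (A : 'M[R]_n) (a : 'cV[R]_d -> 'cV[R]_n) :
  eq_fdd P X Y ->
  eq_fdd P (fun t w => A *m X t w + a t) (fun t w => A *m Y t w + a t).
Proof.
move=> XY k t; rewrite !joint_affine.
exact: (@eq_law_affine _ _ _ P _ _ _ A _ (joint X t) (joint Y t) (XY k t)).
Qed.

Lemma eq_fdd_trans X Y Z : eq_fdd P X Y -> eq_fdd P Y Z -> eq_fdd P X Z.
Proof. by move=> XY YZ k t B mB; rewrite XY// YZ. Qed.

Lemma eq_fdd_sym X Y : eq_fdd P X Y -> eq_fdd P Y X.
Proof. by move=> XY k t B mB; rewrite XY. Qed.

Lemma mx_measurable_joint X k (t : 'I_k -> 'cV[R]_d) :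
  (forall t, mx_measurable (X t)) -> mx_measurable (joint X t).
Proof.
move=> mX; apply: mx_measurable_entries => i j B oB.
rewrite (_ : [set w | _] = [set w | B (X (t j) w i 0)]).
  exact: mx_measurable_entry.
by apply/seteqP; split => w /=; rewrite mxE.
Qed.

Lemma cvg_prob_joint J (F : set_system J) X (f : J -> 'cV[R]_d -> 'cV[R]_d)
    (f0 : 'cV[R]_d -> 'cV[R]_d) k (t : 'I_k -> 'cV[R]_d) : Filter F ->
  (forall s, cvg_prob P F (fun i => X (f i s)) (X (f0 s))) ->
  cvg_prob P F (fun i => joint (X \o f i) t) (joint (X \o f0) t).
Proof.
by move=> FF XF; apply: cvg_prob_columns => j; exact: XF.
Qed.

Lemma ae_eq_law m k (Y : T -> 'M[R]_(m, k)) a : mx_measurable Y ->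
  {ae P, forall w, Y w = a} -> eq_law P Y (fun=> a).
Proof.
move=> mY [N [mN PN YN]] B mB.
have mYB : measurable (Y @^-1` B) by rewrite -[X in measurable X]setTI; exact: mY.
have maB : measurable ((fun=> a) @^-1` B : set T).
  have [aB|aB] := pselect (B a).
    by rewrite (_ : _ @^-1` _ = setT)//; apply/seteqP; split.
  by rewrite (_ : _ @^-1` _ = set0)//; apply/seteqP; split.
have off (Q : T -> Prop) : (forall w, Y w = a -> Q w) -> holds_off P 0 Q.
  move=> aQ; exists N; split => //; first by rewrite PN.
  by move=> w Nw; apply: aQ; apply: contrapT => Yw; exact: Nw (YN w Yw).
apply/eqP; rewrite eq_le; apply/andP; split.
  rewrite -[leRHS]adde0; apply: holds_off_le => //.
  by apply: off => w /= ->.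
rewrite -[leRHS]adde0; apply: holds_off_le => //.
by apply: off => w /= ->.
Qed.

Lemma eq_law_ae m k (Y : T -> 'M[R]_(m, k)) a : mx_measurable Y ->
  eq_law P Y (fun=> a) -> {ae P, forall w, Y w = a}.
Proof.
move=> mY Ya.
have ma : @measurable _ (borel 'M[R]_(m, k)) [set~ a].
  apply: sub_sigma_algebra; apply: closed_openC.
  exact: (accessible_closed_set1 (hausdorff_accessible (@norm_hausdorff _ _))).
exists (Y @^-1` [set~ a]); split.
- by rewrite -[X in measurable X]setTI; exact: mY.
- rewrite Ya// (_ : _ @^-1` _ = set0) ?measure0//.
  by apply/seteqP; split => // w /=; apply.
- by [].
Qed.

Lemma eq_law_cst m k (a b : 'M[R]_(m, k)) :
  eq_law P (fun=> a) (fun=> b) -> a = b.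
Proof.
move=> ab; have m0 : mx_measurable (fun _ : T => 0 : 'M[R]_(m, k)).
  exact: measurable_cst.
by apply: (eq_law_shift_inj m0 (P := P)); rewrite !add0r.
Qed.

End FiniteDimensionalLaws.

Section SelfSimilarField.
Context {R : realType} {d n : nat} {disp : measure_display}.
Context {T : measurableType disp}.
Variables (P : probability T R) (X : 'cV[R]_d.+1 -> T -> 'cV[R]_n.+1).
Variable E : 'M[R]_d.+1.
Hypothesis X_measurable : random_field X.
Hypothesis X_cont : stochastically_continuous P X.
Hypothesis X_proper : proper_field P X.
Hypothesis X_woss : woss P E X.

Let mX t : mx_measurable (X t). Proof. exact: X_measurable. Qed.

Let X_cvg J (F : set_system J) (f : J -> 'cV[R]_d.+1) (t : 'cV[R]_d.+1) :
  Filter F -> f @ F --> t -> cvg_prob P F (fun i => X (f i)) (X t).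
Proof.
move=> FF ft e dl e0 dl0.
have mN s : measurable [set w | e < `|X s w - X t w|].
  apply: (mx_measurable_norm_gt e (X := fun w => X s w - X t w)).
  have sub_cts : continuous
      (fun xy : 'cV[R]_n.+1 * 'cV[R]_n.+1 => xy.1 - xy.2).
    move=> [x y]; apply: cvgB; [exact: cvg_fst|exact: cvg_snd].
  exact: (mx_measurable_pair (f := fun x y => x - y) (mX s) (mX t) sub_cts).
have := X_cont t e0 => /fine_cvgP[_ /cvgr0Pnorm_le/(_ _ dl0)] h.
have hf : \forall i \near F,
    `|fine (P [set w | e < `|X (f i) w - X t w|])| <= dl by exact: (ft _ h).
apply: filterS hf => i hi.
exists [set w | e < `|X (f i) w - X t w|]; split => //.
  by rewrite -[P _]fineK ?fin_num_measure// lee_fin (le_trans (ler_norm _)).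
by move=> w /negP; rewrite -leNgt.
Qed.

(** The parameter [s] is the logarithm of the scale [r], which makes [scaling] an
    additive group in [s]; the shift function is left existential because it is
    determined by [A]. *)
Definition scaling (s : R) (A : 'M[R]_n.+1) : Prop :=
  exists a, eq_fdd P (fun t => X (mexp E s *m t)) (fun t w => A *m X t w + a t).

Let e0 : 'cV[R]_d.+1 := const_mx 1.

Let e0_neq0 : e0 != 0.
Proof. by apply/cV0Pn; exists 0; rewrite mxE oner_eq0. Qed.

Lemma scaling_mul s t A B :
  scaling s A -> scaling t B -> scaling (s + t) (A *m B).
Proof.
move=> [a Xa] [b Xb]; exists (fun u => A *m b u + a (mexp E t *m u)).
have h1 := eq_fdd_reindex (fun u => mexp E t *m u) Xa.
have h2 := eq_fdd_affine A (fun u => a (mexp E t *m u)) Xb.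
have := eq_fdd_trans h1 h2; congr eq_fdd; apply/funext => u.
  by rewrite /= mexpD mulmxA.
by apply/funext => w; rewrite mulmxDr mulmxA addrA.
Qed.

(** Self-similarity turns a kernel of [A] into a degenerate projection of the field
    at a nonzero time, which properness forbids. *)
Lemma scaling_inv s A : scaling s A -> A \in unitmx /\ scaling (- s) (invmx A).
Proof.
move=> [a Xa].
have uA : A \in unitmx.
  rewrite unitmxE unitfE; apply/negP => /det0P[c c0 cA].
  have /X_proper full_Xs : mexp E s *m e0 != 0.
    apply: contra_neq e0_neq0 => h.
    by rewrite -[e0]mul1mx -(mexpNK E s) -mulmxA h mulmx0.
  move/eqP : c0; apply; apply: (full_not_degenerate (a := c *m a e0) full_Xs).
  have := eq_law_affine c 0 (eq_fdd_marginal e0 Xa).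
  under [Z in eq_law _ Z _]eq_fun do rewrite addr0.
  by under [Z in eq_law _ _ Z]eq_fun do rewrite addr0 mulmxDr mulmxA cA mul0mx add0r.
split => //; exists (fun t => - (invmx A *m a (mexp E (- s) *m t))).
have h1 := eq_fdd_reindex (fun u => mexp E (- s) *m u) Xa.
have := eq_fdd_sym (eq_fdd_affine (invmx A)
  (fun t => - (invmx A *m a (mexp E (- s) *m t))) h1).
congr eq_fdd; apply/funext => u; apply/funext => w /=.
  by rewrite mulmxDr mulmxA mulVmx// mul1mx addrK.
by rewrite mulmxA mexpKN mul1mx.
Qed.

Lemma scaling_ex s : exists A, scaling s A.
Proof.
have [_ h] := X_woss; have [A [a Xa]] := h (expR s) (expR_gt0 s).
by exists A, a; rewrite /rpowmx expRK in Xa.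
Qed.

Let scaling_limit J (U : set_system J) (f : J -> 'M[R]_d.+1) F0
    (A : J -> 'M[R]_n.+1) (a : J -> 'cV[R]_d.+1 -> 'cV[R]_n.+1) : UltraFilter U ->
  f @ U --> (F0 : 'M[R]_d.+1) ->
  (forall i, eq_fdd P (fun t => X (f i *m t)) (fun t w => A i *m X t w + a i t)) ->
  exists A0 : 'M[R]_n.+1, exists c0, A @ U --> A0 /\
    eq_law P (X (F0 *m e0)) (fun w => A0 *m X e0 w + c0).
Proof.
move=> UU fU XA.
have ft : (fun i => f i *m e0) @ U --> F0 *m e0.
  by apply: mulmx_cvg => //; exact: cvg_cst.
have [A0 [c0 [AA0 _ h]]] := convergence_of_types UU (mX _) (mX e0)
  (fun i => mX (f i *m e0)) (X_proper e0_neq0) (X_cvg _ ft)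
  (fun i => eq_fdd_marginal e0 (XA i)).
by exists A0, c0.
Qed.

Let mAX (A : 'M[R]_n.+1) t : mx_measurable (fun w => A *m X t w).
Proof.
have := mx_measurable_affine A 0 (mX t).
by under eq_fun do rewrite addr0.
Qed.

Let AX_cvg J (U : set_system J) (A : J -> 'M[R]_n.+1) (A0 : 'M[R]_n.+1)
    (f : J -> 'cV[R]_d.+1) (t : 'cV[R]_d.+1) : Filter U -> A @ U --> A0 -> f @ U --> t ->
  cvg_prob P U (fun i w => A i *m X (f i) w) (fun w => A0 *m X t w).
Proof.
move=> FU AA0 ft.
have h : cvg_prob P U (fun i w => A i *m X (f i) w + (0 : 'cV[R]_n.+1))
    (fun w => A0 *m X t w + 0).
  by apply: cvg_prob_affine => //; [exact: cvg_cst|exact: X_cvg].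
move=> e dl e1 dl1; apply: filterS (h e dl e1 dl1) => i; apply: holds_offW => //.
by move=> w; rewrite !addr0.
Qed.

(** The law at the single time [e0] is full and forces the matrices to converge;
    then the shifts converge at every time, simultaneously since [U] is an
    ultrafilter, and all finite-dimensional equalities in law pass to the limit. *)
Lemma scaling_compact (U : set_system nat) (s : nat -> R)
    (A : nat -> 'M[R]_n.+1) (sigma : R) : UltraFilter U -> s @ U --> sigma ->
  (forall k, scaling (s k) (A k)) -> exists2 B, A @ U --> B & scaling sigma B.
Proof.
move=> UU sU /choice[a Xa].
have EU : (fun k => mexp E (s k)) @ U --> mexp E sigma.
  exact: (cvg_comp _ _ sU (@mexp_cts _ _ E sigma)).
have [B [_ [AB _]]] := scaling_limit UU EU Xa; exists B => //.
have EtU (t : 'cV[R]_d.+1) : (fun k => mexp E (s k) *m t) @ U --> mexp E sigma *m t.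
  by apply: mulmx_cvg => //; exact: cvg_cst.
have /choice[b bP] : forall t, exists b : 'cV[R]_n.+1, a ^~ t @ U --> b.
  move=> t; have [b ab _] := shift_cvg UU (mX (mexp E sigma *m t)) (mAX B t)
    (fun k => mX (mexp E (s k) *m t)) (fun k => mAX (A k) t) (X_cvg _ (EtU t))
    (AX_cvg _ AB (cvg_cst t)) (fun k => eq_fdd_marginal t (Xa k)).
  by exists b.
exists b => k t; rewrite joint_affine.
apply: (@eq_law_lim _ _ _ P _ U _ _
  (fun i => joint (X \o (fun u => mexp E (s i) *m u)) t)
  (fun i w => A i *m joint X t w + \matrix_(l, j) a i (t j) l 0)) => //.
- by apply: mx_measurable_joint => u; exact: mX.
- by apply: mx_measurable_affine; exact: mx_measurable_joint.
- by move=> i; apply: mx_measurable_joint => u; exact: mX.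
- by move=> i; apply: mx_measurable_affine; exact: mx_measurable_joint.
- by apply: cvg_prob_joint => u; exact: X_cvg.
- apply: cvg_prob_affine => //; first exact: mx_measurable_joint.
    apply/mx_cvgP => l j; rewrite mxE; under eq_fun do rewrite mxE.
    by have /mx_cvgP := bP (t j); apply.
  exact: cvg_prob_cst.
- by move=> i; have := Xa i k t; rewrite joint_affine.
Qed.

Lemma scaling_exponent : exists D : 'M[R]_n.+1, forall s, scaling s (mexp D s).
Proof.
exact: (one_parameter_section scaling_mul scaling_inv scaling_ex scaling_compact).
Qed.

(** * Exponent and shifts near scale zero *)

Section Exponent.
Variable D : 'M[R]_n.+1.
Hypothesis D_scaling : forall s, scaling s (mexp D s).

Let E_decay : mexp E s @[s --> -oo] --> (0 : 'M[R]_d.+1).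
Proof. by apply: mexp_decay; have [] := X_woss. Qed.

Let limit_at_Ny J (U : set_system J) (s : J -> R) : UltraFilter U ->
  s @ U --> -oo -> exists A0 : 'M[R]_n.+1, exists c0,
    (fun i => mexp D (s i)) @ U --> A0 /\
    eq_law P (X 0) (fun w => A0 *m X e0 w + c0).
Proof.
move=> UU sU; have /choice[a Xa] : forall i, exists a, eq_fdd P
    (fun t => X (mexp E (s i) *m t)) (fun t w => mexp D (s i) *m X t w + a t).
  by move=> i; exact: D_scaling.
have EU : (fun i => mexp E (s i)) @ U --> (0 : 'M[R]_d.+1).
  exact: (cvg_comp _ _ sU E_decay).
have := scaling_limit UU EU Xa.
by rewrite mul0mx.
Qed.

(** Convergence of types along scales tending to 0, where the field at [e0]
    converges to [X 0]. *)
Lemma exponent_bounded :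
  exists K s0, forall s, s <= s0 -> `|mexp D s| <= K.
Proof.
apply: contrapT => unbounded.
have /choice[s sP] : forall k : nat, exists s, s <= - k%:R /\ k%:R < `|mexp D s|.
  move=> k; apply: contrapT => nk; apply: unbounded; exists k%:R, (- k%:R) => s sk.
  by rewrite leNgt; apply/negP => ks; apply: nk; exists s.
have [U [UU ooU]] := @ultraFilterLemma nat \oo _.
have kU (K : R) : \forall k \near U, K <= k%:R.
  apply: ooU; exists (Num.truncn K).+1 => // k /= Kk.
  by rewrite ltW// (lt_le_trans (truncnS_gt _))// ler_nat.
have sU : s @ U --> -oo.
  apply/cvgrNyPle => K; apply: filterS (kU (- K)) => k Kk.
  by have [sk _] := sP k; rewrite (le_trans sk)// lerNl.
have [A0 [_ [AA0 _]]] := limit_at_Ny UU sU.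
have : \forall k \near U, `|mexp D (s k)| <= `|A0| + 1.
  move/cvgrPdist_le : AA0 => /(_ _ ltr01); apply: filterS => k h.
  by rewrite -lerBlDl (le_trans _ h)// distrC (le_trans (lerB_dist _ _)).
move=> bd; have [k [k1 k2]] := filter_ex (filterI bd (kU (`|A0| + 1))).
have [_ k3] := sP k.
by have := lt_le_trans k3 (le_trans k1 k2); rewrite ltxx.
Qed.

(** A limit point [A0] of the scalings sends the full law of [X e0] to that of
    [X 0], up to a shift; if the latter is a point mass then [A0 = 0]. *)
Lemma degenerate_exponent_decay a : {ae P, forall w, X 0 w = a} ->
  mexp D s @[s --> -oo] --> (0 : 'M[R]_n.+1).
Proof.
move=> X0a; apply: ultra_cvgP => U UU NyU.
have [A0 [c0 [AA0 law0]]] := limit_at_Ny UU (NyU : (id : R -> R) @ U --> -oo).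
suff A00 : A0 = 0 by rewrite A00 in AA0.
apply: (full_not_degenerate (a := a - c0) (X_proper e0_neq0)).
have := eq_law_trans (eq_law_sym law0) (ae_eq_law (mX 0) X0a).
move=> /(eq_law_affine 1%:M (- c0)).
under [Z in eq_law _ Z _]eq_fun do rewrite mul1mx addrK.
by rewrite mul1mx.
Qed.

(** Time 0 is fixed by every [mexp E s], so [X 0] has the law of
    [mexp D s *m X 0] plus a shift, and the random part vanishes in the limit. *)
Lemma exponent_decay_degenerate :
  mexp D s @[s --> -oo] --> (0 : 'M[R]_n.+1) ->
  exists a, {ae P, forall w, X 0 w = a}.
Proof.
move=> D0; have [U [UU NyU]] := @ultraFilterLemma R -oo _.
have /choice[a Xa] : forall s, exists a : 'cV[R]_n.+1,
    eq_law P (X 0) (fun w => mexp D s *m X 0 w + a).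
  move=> s; have [a Xa] := D_scaling s; exists (a 0).
  by have := eq_fdd_marginal 0 Xa; rewrite mulmx0.
have DU : mexp D @ U --> (0 : 'M[R]_n.+1).
  by move=> B /D0 h; exact: NyU.
have DX : cvg_prob P U (fun s w => mexp D s *m X 0 w) (fun w => 0 *m X 0 w).
  exact: (AX_cvg (f := fun=> 0) _ DU (cvg_cst (0 : 'cV[R]_d.+1))).
have [c0 _ law0] := shift_cvg UU (mX 0) (mAX 0 0) (fun=> mX 0)
  (fun s => mAX (mexp D s) 0) (cvg_prob_cst P (X 0) _) DX Xa.
exists c0; apply: (eq_law_ae (mX 0)); move: law0.
by under [Z in eq_law _ _ Z]eq_fun do rewrite mul0mx add0r.
Qed.

Variable b : R -> 'cV[R]_d.+1 -> 'cV[R]_n.+1.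
Hypothesis b_scaling : forall s,
  eq_fdd P (fun t => X (mexp E s *m t)) (fun t w => mexp D s *m X t w + b s t).

Let shift_limit J (U : set_system J) (s : J -> R) (t : J -> 'cV[R]_d.+1)
    (E0 : 'M[R]_d.+1) (D0 : 'M[R]_n.+1) (t0 : 'cV[R]_d.+1) : UltraFilter U ->
  (fun i => mexp E (s i)) @ U --> E0 -> (fun i => mexp D (s i)) @ U --> D0 ->
  t @ U --> t0 ->
  exists2 c0 : 'cV[R]_n.+1, (fun i => b (s i) (t i)) @ U --> c0 &
    eq_law P (X (E0 *m t0)) (fun w => D0 *m X t0 w + c0).
Proof.
move=> UU EU DU tU.
have EtU : (fun i => mexp E (s i) *m t i) @ U --> E0 *m t0 by exact: mulmx_cvg.
exact: (shift_cvg UU (mX (E0 *m t0)) (mAX D0 t0)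
  (fun i => mX (mexp E (s i) *m t i)) (fun i => mAX (mexp D (s i)) (t i))
  (X_cvg _ EtU) (AX_cvg _ DU tU) (fun i => eq_fdd_marginal (t i) (b_scaling (s i)))).
Qed.

(** Any limit point of the shifts satisfies the same equality in law as
    [b s0 t0], and a shift is determined by that equality. *)
Lemma shift_continuous J (F : set_system J) (s : J -> R)
    (t : J -> 'cV[R]_d.+1) (s0 : R) (t0 : 'cV[R]_d.+1) : Filter F ->
  s @ F --> s0 -> t @ F --> t0 -> (fun i => b (s i) (t i)) @ F --> b s0 t0.
Proof.
move=> FF sF tF; apply: ultra_cvgP => U UU FU.
have sU : s @ U --> s0 by move=> B /sF; exact: FU.
have tU : t @ U --> t0 by move=> B /tF; exact: FU.
have [c0 bc0 law0] := shift_limit UU (cvg_comp _ _ sU (@mexp_cts _ _ E s0))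
  (cvg_comp _ _ sU (@mexp_cts _ _ D s0)) tU.
suff -> : b s0 t0 = c0 by [].
apply: (eq_law_shift_inj (mAX (mexp D s0) t0) (P := P)).
exact: eq_law_trans (eq_law_sym (eq_fdd_marginal t0 (b_scaling s0))) law0.
Qed.

Lemma shift_cvg_degenerate J (F : set_system J) (s : J -> R)
    (t : J -> 'cV[R]_d.+1) (t0 : 'cV[R]_d.+1) a : Filter F ->
  {ae P, forall w, X 0 w = a} ->
  s @ F --> -oo -> t @ F --> t0 -> (fun i => b (s i) (t i)) @ F --> a.
Proof.
move=> FF X0a sF tF; apply: ultra_cvgP => U UU FU.
have sU : s @ U --> -oo by move=> B /sF; exact: FU.
have tU : t @ U --> t0 by move=> B /tF; exact: FU.
have [c0 bc0 law0] := shift_limit UU (cvg_comp _ _ sU E_decay)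
  (cvg_comp _ _ sU (degenerate_exponent_decay X0a)) tU.
suff -> : a = c0 by [].
rewrite mul0mx in law0; apply: (eq_law_cst (P := P)).
have := eq_law_trans (eq_law_sym (ae_eq_law (mX 0) X0a)) law0.
by under [Z in eq_law _ _ Z]eq_fun do rewrite mul0mx add0r.
Qed.

End Exponent.

End SelfSimilarField.

Theorem theorem2p1 (R : realType) (d m : nat)
    (hd : (2 <= d)%N) (hm : (2 <= m.+1)%N)
    (disp : measure_display) (T : measurableType disp) (P : probability T R)
    (X : 'cV[R]_d -> T -> 'cV[R]_m.+1) (E : 'M[R]_d)
    (hX : random_field X)
    (hcont : stochastically_continuous P X)
    (hproper : proper_field P X)
    (hwoss : woss P E X) :
  exists (D : 'M[R]_m.+1) (b : R -> 'cV[R]_d -> 'cV[R]_m.+1),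
    [/\ Mmx D,
        forall (r : R) (t : 'cV[R]_d), 0 < r ->
          {for (r, t), continuous (fun p : R * 'cV[R]_d => b p.1 p.2)},
        forall r : R, 0 < r ->
          eq_fdd P (fun t => X (rpowmx r E *m t))
                   (fun t w => rpowmx r D *m X t w + b r t),
        (exists a : 'cV[R]_m.+1, {ae P, forall w, X 0 w = a}) <-> Qmx D
      & forall a : 'cV[R]_m.+1, {ae P, forall w, X 0 w = a} ->
          {within [set p : R * 'cV[R]_d | 0 <= p.1],
            continuous (fun p : R * 'cV[R]_d =>
              if p.1 == 0 then a else b p.1 p.2)}].
Proof.
case: d hd X E hX hcont hproper hwoss => // d _ X E hX hcont hproper hwoss.
have [D D_scaling] := scaling_exponent hX hcont hproper hwoss.
have /choice[b bP] := D_scaling.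
have bcont (r : R) (t : 'cV[R]_d.+1) : 0 < r ->
    {for (r, t), continuous (fun p : R * 'cV[R]_d.+1 => b (ln p.1) p.2)}.
  move=> r0.
  have c1 : (fun p : R * 'cV[R]_d.+1 => p.1) @ (r, t) --> r by exact: cvg_fst.
  have c2 : (fun p : R * 'cV[R]_d.+1 => p.2) @ (r, t) --> t by exact: cvg_snd.
  have lnc : (fun p : R * 'cV[R]_d.+1 => ln p.1) @ (r, t) --> ln r.
    exact: (cvg_comp _ _ c1 (continuous_ln r0)).
  exact: (shift_continuous hX hcont bP _ lnc c2).
exists D, (fun r => b (ln r)); split => //.
- have [K [s0 DK]] := exponent_bounded hX hcont hproper hwoss D_scaling.
  exact: bounded_mexp_Mmx DK.
- by move=> r _; exact: bP.
- split=> [[a X0a]|QD].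
    apply: mexp_decay_Qmx.
    exact: (degenerate_exponent_decay hX hcont hproper hwoss D_scaling X0a).
  exact: (exponent_decay_degenerate hX hcont D_scaling (mexp_decay QD)).
move=> a X0a.
pose g (p : R * 'cV[R]_d.+1) := if p.1 == 0 then a else b (ln p.1) p.2.
set S := [set p : R * 'cV[R]_d.+1 | 0 <= p.1].
suff g_cts (r : R) (t : 'cV[R]_d.+1) : 0 <= r -> g @ within S (nbhs (r, t)) --> g (r, t).
  by apply/subspace_continuousP => -[r t]; exact: g_cts.
move=> r0; have [r_eq0|r_neq0] := eqVneq r 0; last first.
  have rgt0 : 0 < r by rewrite lt_neqAle eq_sym r_neq0.
  apply: cvg_within_filter.
  have nearE : {near (r, t), (fun p => b (ln p.1) p.2) =1 g}.
    have : \forall p \near (r, t), 0 < p.1.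
      have c1 : (fun p : R * 'cV[R]_d.+1 => p.1) @ (r, t) --> r by exact: cvg_fst.
      exact: (c1 _ (lt_nbhsr rgt0)).
    by apply: filterS => p p0; rewrite /g gt_eqF.
  have -> : g (r, t) = b (ln r) t by rewrite /g /= (negbTE r_neq0).
  exact: (cvg_trans (near_eq_cvg nearE) (bcont r t rgt0)).
rewrite {}r_eq0 {r0}; have -> : g (0, t) = a by rewrite /g /= eqxx.
have SS : within S (nbhs ((0 : R), t)) S by apply: withinT.
apply: ultra_cvgP => U UU SU.
(* an ultrafilter sits either on the boundary, where [g] is constant, or inside,
   where the scale tends to 0 and its logarithm to minus infinity *)
have [U0|U0] := in_ultra_setVsetC [set p | p.1 == 0] UU.
  by apply: cvg_near_cst; apply: filterS U0 => p; rewrite /g /= => ->.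
have Upos : \forall p \near U, 0 < p.1.
  by apply: filterS2 U0 (SU _ SS) => p /= /negP p0 p1; rewrite lt_neqAle eq_sym p0.
have fstU : fst @ U --> (0 : R)^'+.
  move=> B; rewrite /at_right /within/= => h.
  have h0 : U [set p | 0 < p.1 -> B p.1].
    apply: SU; apply: (cvg_within (F := nbhs (0, t))).
    have c1 : (fun p : R * 'cV[R]_d.+1 => p.1) @ ((0 : R), t) --> (0 : R).
      exact: cvg_fst.
    exact: (c1 _ h).
  by apply: filterS2 h0 Upos => p; apply.
have sndU : snd @ U --> t.
  move=> B Bt; apply: SU; apply: (cvg_within (F := nbhs (0, t))).
  have c2 : (fun p : R * 'cV[R]_d.+1 => p.2) @ ((0 : R), t) --> t.
    exact: cvg_snd.
  exact: (c2 _ Bt).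
have lnU : (fun p => ln p.1) @ U --> -oo by exact: (cvg_comp _ _ fstU (@lnNy R)).
have bU : (fun p => b (ln p.1) p.2) @ U --> a.
  exact: (shift_cvg_degenerate hX hcont hproper hwoss D_scaling bP _ X0a lnU sndU).
apply: cvg_trans bU; apply: near_eq_cvg; apply: filterS Upos => p p0.
by rewrite /g gt_eqF.
Qed.
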